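(* Let $K$ be an infinite field, $R=K[x_1,\ldots,x_n]$ the polynomial ring in $n\ge 1$ variables with the standard grading, and $\mathfrak m=(x_1,\ldots,x_n)$. Let $I$ be a homogeneous $\mathfrak m$-primary $\mathfrak m$-full ideal of $R$, and let $d$ be the minimum of all $j$ with $\beta_{n-1,n-1+j}(I)>0$. Suppose that for some linear form $x$ in $R$ one has $\mathfrak m I:x=I$ and $\overline I=(I+xR)/xR$ is $\mathfrak m$-full as an ideal of $R/xR$. Then the following conditions are equivalent. (i) $R/I$ has the weak Lefschetz property. (ii) $\beta_{n-1,n-1+j}(I)=\beta_{0,j}(I)$ for all $j>d$. (iii) $\beta_{i,i+j}(I)=\binom{n-1}{i}\beta_{0,j}(I)$ for all $j>d$ and all $i$.
   Context: An ideal $I$ of a polynomial ring $R$ with homogeneous maximal ideal $\mathfrak m$ is $\mathfrak m$-full if there exists an element $x\in R$ such that $\mathfrak m I:x=I$. For a nonzero linear form $x\in R$, the ring $R/xR$ is (isomorphic to) a standard graded polynomial ring in $n-1$ variables, and $\mathfrak m$-fullness of an ideal of $R/xR$ is understood with respect to its homogeneous maximal ideal $\mathfrak m/xR$. $\beta_{i,j}(I)$ denotes the $(i,j)$th graded Betti number of $I$ as a graded $R$-module, i.e. $\beta_{i,j}(I)=\dim_K \mathrm{Tor}^R_i(I,K)_j$. For an $\mathfrak m$-primary homogeneous ideal $I$, write $A=R/I=\bigoplus_{i=0}^c A_i$ with $A_c\neq 0$. $A$ has the weak Lefschetz property (WLP) if there exists a linear form $L\in A_1$ such that the multiplication map $\times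 L:A_i\to A_{i+1}$ has full rank (i.e. is injective or surjective) for all $0\le i\le c-1$. *)

(* Defs.v *)
From HB Require Import structures.
From mathcomp Require Import all_boot all_order all_algebra.
From mathcomp Require Import ring_quotient mpoly.
From Stdlib Require Import ClassicalEpsilon.

Set Implicit Arguments.
Unset Strict Implicit.
Unset Printing Implicit Defensive.

Import GRing.Theory.
Local Open Scope ring_scope.
Local Open Scope quotient_scope.

Definition infinite_field (K : fieldType) : Prop :=
  forall s : seq K, exists a : K, a \notin s.

Section IdealOperations.
Variable S : comNzRingType.

Definition ideal_mul (A B : S -> Prop) (f : S) : Prop :=
  exists2 s : seq (S * S),
    (forall p, p \in s -> A p.1 /\ B p.2) & f = \sum_(p <- s) p.1 * p.2.

Definition colon (A : S -> Prop) (x f : S) : Prop := A (x * f).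

(* m I : x = I *)
Definition mfull_at (m I : S -> Prop) (x : S) : Prop :=
  forall f, colon (ideal_mul m I) x f <-> I f.

Definition mfull (m I : S -> Prop) : Prop := exists x, mfull_at m I x.

Definition primary (Q : idealr S) : Prop :=
  forall f g, f * g \in Q -> f \in Q \/ exists k, g ^+ k \in Q.

Definition radical (Q : idealr S) (f : S) : Prop := exists k, f ^+ k \in Q.

(* The image of a subset of S in the quotient ring S / J. *)
Definition quot_image (J : idealr S) (A : S -> Prop) (a : {ideal_quot J}) :
  Prop := exists2 f, A f & a = \pi_({ideal_quot J}) f.

End IdealOperations.

Section PolynomialRing.
Variables (K : fieldType) (n : nat).
Local Notation R := {mpoly K[n]}.

(* The ideal (x_1, ..., x_n). *)
Definition irrelevant (f : R) : Prop :=
  exists g : 'I_n -> R, f = \sum_i g i * 'X_i.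

Definition homogeneous_ideal (I : idealr R) : Prop :=
  forall f d, f \in I -> pihomog mdeg d f \in I.

Definition irrelevant_primary (I : idealr R) : Prop :=
  primary I /\ forall f, radical I f <-> irrelevant f.

(* Principal ideal x R of a linear form x.  The proof argument makes it a
   proper ideal, as needed to form the ring {ideal_quot _}. *)
Definition lin_ideal (x : R) & x \is 1.-homog : pred R :=
  fun f => if excluded_middle_informative (exists g, f = x * g)
           then true else false.

Lemma lin_idealP (x : R) (xL : x \is 1.-homog) (f : R) :
  reflect (exists g, f = x * g) (f \in lin_ideal xL).
Proof.
by rewrite unfold_in /lin_ideal; case: excluded_middle_informative => h;
  constructor.
Qed.

Lemma lin_ideal_closed (x : R) (xL : x \is 1.-homog) :
  idealr_closed (lin_ideal xL).
Proof.
split.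
- by apply/lin_idealP; exists 0; rewrite mulr0.
- have x0 : x@_0%MM = 0 by apply: (dhomog_nemf_coeff xL); rewrite /= mdeg0.
  apply/lin_idealP => -[g /(congr1 (mcoeff 0%MM))] /eqP.
  rewrite (mcoeff0_is_multiplicative n K).1 x0 mul0r mcoeff1 eqxx.
  by rewrite oner_eq0.
move=> a f h /lin_idealP[u ->] /lin_idealP[v ->]; apply/lin_idealP.
by exists (a * u + v); rewrite mulrDr mulrCA.
Qed.

HB.instance Definition _ (x : R) (xL : x \is 1.-homog) :=
  isIdealr.Build R (lin_ideal xL) (lin_ideal_closed xL).

(* A_i for A = R / I. *)
Definition quot_piece (I : idealr R) (i : nat) : {ideal_quot I} -> Prop :=
  quot_image (J := I) (fun f => f \is i.-homog).

Definition WLP (I : idealr R) : Prop :=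
  exists c : nat,
  [/\ exists2 a, quot_piece (I := I) c a & a <> 0,
      forall i, (c < i)%N -> forall a, quot_piece (I := I) i a -> a = 0
    & exists2 L, quot_piece (I := I) 1 L &
        forall i, (i < c)%N ->
          (forall a b, quot_piece i a -> quot_piece i b ->
             L * a = L * b -> a = b)
          \/ (forall b, quot_piece i.+1 b ->
                exists2 a, quot_piece i a & b = L * a)].

(* F_i is the graded free R-module of rank grank i whose p-th basis vector has
   degree gdeg i p.  Elements are row vectors, and matrices act on the right:
   gdiff i : F_(i+1) -> F_i and gaug : F_0 -> R. *)
Record free_complex := FreeComplex {
  grank : nat -> nat;
  gdeg : forall i, 'I_(grank i) -> nat;
  gdiff : forall i, 'M[R]_(grank i.+1, grank i);
  gaug : 'cV[R]_(grank 0)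
}.

Arguments gdeg : clear implicits.

(* F is a graded free resolution of I, with maps homogeneous of degree 0. *)
Record graded_free_resolution (I : idealr R) (F : free_complex) : Prop := {
  gdiff_homog : forall i p q, {in msupp (gdiff F i p q), forall m,
    (mdeg m + gdeg F i q = gdeg F i.+1 p)%N};
  gaug_homog : forall p, gaug F p 0 \is (gdeg F 0 p).-homog;
  gaug_image : forall f,
    f \in I <-> exists u : 'rV[R]_(grank F 0), f = (u *m gaug F) 0 0;
  gexact0 : forall u : 'rV[R]_(grank F 0),
    u *m gaug F = 0 <-> exists v, u = v *m gdiff F 0;
  gexactS : forall i (u : 'rV[R]_(grank F i.+1)),
    u *m gdiff F i = 0 <-> exists v, u = v *m gdiff F i.+1
}.

(* Since K = R / m, the complex F (x)_R K has terms K^(grank i), and its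
   differentials are the constant coefficients of those of F. *)
Definition fiber_diff (F : free_complex) (i : nat) :
  'M[K]_(grank F i.+1, grank F i) := map_mx (mcoeff 0%MM) (gdiff F i).

Definition fiber_out (F : free_complex) (i : nat) :
  'M[K]_(grank F i, grank F i.-1) :=
  match i with 0 => 0 | i'.+1 => fiber_diff F i' end.

(* Its row space is the degree j component of F_i (x)_R K. *)
Definition degree_mx (F : free_complex) (i j : nat) : 'M[K]_(grank F i) :=
  diag_mx (\row_p (gdeg F i p == j)%:R).

(* dim_K H_i(F (x)_R K)_j : degree j cycles minus degree j boundaries. *)
Definition fiber_homology_dim (F : free_complex) (i j : nat) : nat :=
  (\rank (degree_mx F i j :&: kermx (fiber_out F i))%MS
   - \rank (degree_mx F i.+1 j *m fiber_diff F i))%N.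

Definition zero_complex : free_complex :=
  @FreeComplex (fun=> 0%N) (fun _ _ => 0%N) (fun=> 0) 0.

Definition resolution (I : idealr R) : free_complex :=
  epsilon (inhabits zero_complex) (graded_free_resolution I).

(* beta_(i,j)(I) = dim_K Tor_i^R(I, K)_j *)
Definition betti (I : idealr R) (i j : nat) : nat :=
  fiber_homology_dim (resolution I) i j.

End PolynomialRing.

(* Main.v *)
Require Import Defs.
From HB Require Import structures.
From mathcomp Require Import all_boot all_order all_algebra.
From mathcomp Require Import ring_quotient mpoly zify.
From Stdlib Require Import ClassicalEpsilon.

(** Write A = R / I and J = I + xR. The hypothesis mI : x = I gives
    I : x = I : m, hence ker (x : A -> A(1)) = soc A. Computing Tor(I, K) by a
    Koszul complex whose last linear form is x, one sees that
    s |-> d(e_x /\ s) always embeds Lambda^i(K^(n-1)) (x) (soc A)_(j-1) in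
    Tor_i(I, K)_(i+j), and that it is onto if i = n - 1, or if J contains all
    forms of degree j - 1. For i = n - 1 this says that d - 1 is the least
    degree of a socle element of A. Each of (i), (ii), (iii) is equivalent to:
    J contains all forms of degree d.
    - If it does, the embedding is onto for all i and all j > d, which is
      (iii), and multiplication by x on A is injective below degree d - 1 and
      onto from degree d - 1 on, which gives (i).
    - Given (i), a Lefschetz element L is not injective on the socle in degree
      d - 1, so L is onto there; as ker x = soc A is contained in ker L, so is
      x by a dimension count.
    - Given (ii), a dimension count for i = 0 shows that I / mI is covered by xR
      in degrees above d; m-fullness of I / (I meet xR) then lets one descend
      from large degrees to degree d. *)

(** [betti] reads off a resolution chosen by epsilon, so it says nothing until a graded free
    resolution of I is known to exist, and its fibre homology says nothing about x until it is
    turned into Koszul homology of I. One tool serves both ends: the Koszul complex of a graded free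
    module on linear forms generating m is exact in positive exterior degree. Connecting maps along
    the syzygy modules then carry Tor_i down to I. Placing x last splits Lambda^i as Lambda^i + e_x
    /\ Lambda^(i-1) over the other forms. Since d(e_x /\ s) = x s - e_x /\ d s, the embedding of the
    overview is well defined because x and m have the same annihilator in A, and injective because
    mI : x = I. The descent under (ii) uses an element z with (mI + xR) : z = J. If z is in m and f
    has degree c, the X_i f have degree c + 1, where J contains everything and I lies in mI + xR; so
    z f is in mI + xR and f is in J. If z has a constant term, I lies in mI + xR outright, and
    iterating this forces m = xR; then the claim is trivial as d > 0. *)

Set Implicit Arguments.
Unset Strict Implicit.
Unset Printing Implicit Defensive.

Import GRing.Theory.
Local Open Scope ring_scope.
Local Open Scope quotient_scope.

(** * Dimensions of subquotients *)

Section Subquotients.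
Variables (K : fieldType) (S : nzRingType) (phi : {rmorphism K -> S}).
Variable V : lmodType S.
Implicit Types Z B : V -> Prop.

(** The modules in play usually have infinite dimension over K, which acts through [phi]; only
    certain subquotients are finite. Hence subspaces are predicates and dimension is a relation. *)
Definition subspace Z : Prop :=
  Z 0 /\ forall c u v, Z u -> Z v -> Z (phi c *: u + v).

Definition lin r (v : 'I_r -> V) (c : 'rV[K]_r) : V :=
  \sum_i phi (c 0 i) *: v i.

Definition qindep B r (v : 'I_r -> V) : Prop :=
  forall c, B (lin v c) -> c = 0.

Definition qspan Z B r (v : 'I_r -> V) : Prop :=
  forall z, Z z -> exists c, B (z - lin v c).

(* dim_K (Z / B) = r *)
Definition qdim Z B r : Prop :=
  exists v : 'I_r -> V, [/\ forall i, Z (v i), qspan Z B v & qindep B v].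

Lemma subspaceD Z u v : subspace Z -> Z u -> Z v -> Z (u + v).
Proof. by case=> _ cZ Zu Zv; rewrite -[u]scale1r -(rmorph1 phi); apply: cZ. Qed.

Lemma subspaceZ Z c u : subspace Z -> Z u -> Z (phi c *: u).
Proof. by case=> Z0 cZ Zu; rewrite -[_ *: _]addr0; apply: cZ. Qed.

Lemma subspaceN Z u : subspace Z -> Z u -> Z (- u).
Proof.
by move=> sZ Zu; rewrite -scaleN1r -(rmorph1 phi) -rmorphN; apply: subspaceZ.
Qed.

Lemma subspaceB Z u v : subspace Z -> Z u -> Z v -> Z (u - v).
Proof. by move=> sZ Zu Zv; apply: subspaceD => //; apply: subspaceN. Qed.

Lemma subspace_sum Z (T : Type) (s : seq T) (F : T -> V) :
  subspace Z -> (forall i, Z (F i)) -> Z (\sum_(i <- s) F i).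
Proof.
move=> sZ ZF; elim/big_rec: _ => [|i u _ Zu]; first by case: sZ.
exact: subspaceD.
Qed.

Lemma subspace_lin Z r (v : 'I_r -> V) c :
  subspace Z -> (forall i, Z (v i)) -> Z (lin v c).
Proof. by move=> sZ Zv; apply: subspace_sum => // i; apply: subspaceZ. Qed.

Lemma linN r (v : 'I_r -> V) c : lin v (- c) = - lin v c.
Proof.
by rewrite /lin -sumrN; apply: eq_bigr => i _; rewrite mxE rmorphN scaleNr.
Qed.

Lemma linZ r (v : 'I_r -> V) a c : lin v (a *: c) = phi a *: lin v c.
Proof.
by rewrite /lin scaler_sumr; apply: eq_bigr => i _; rewrite mxE rmorphM scalerA.
Qed.

Lemma lin_mul B r s (v : 'I_r -> V) (w : 'I_s -> V) (A : 'M[K]_(r, s)) c :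
  subspace B -> (forall i, B (v i - lin w (row i A))) ->
  B (lin v c - lin w (c *m A)).
Proof.
move=> sB Bvw.
have -> : lin w (c *m A) = lin (fun i => lin w (row i A)) c.
  rewrite /lin; under [RHS]eq_bigr => i _ do rewrite scaler_sumr.
  rewrite exchange_big; apply: eq_bigr => j _;
    rewrite mxE rmorph_sum scaler_suml.
  by apply: eq_bigr => i _; rewrite mxE rmorphM scalerA.
rewrite /lin -sumrB; apply: subspace_sum => // i.
by rewrite -scalerBr; apply: subspaceZ.
Qed.

(** The coefficients form a matrix over K, through which comparing dimensions becomes a matter of
    matrix rank. *)
Lemma qspan_mx Z B r s (v : 'I_r -> V) (w : 'I_s -> V) :
  (forall i, Z (v i)) -> qspan Z B w ->
  exists A : 'M[K]_(r, s), forall i, B (v i - lin w (row i A)).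
Proof.
move=> Zv wS; have /fin_all_exists[a Ba] := fun i => wS _ (Zv i).
by exists (\matrix_i a i) => i; rewrite rowK.
Qed.

Lemma qindep_row_free B r s (v : 'I_r -> V) (w : 'I_s -> V)
    (A : 'M[K]_(r, s)) :
  subspace B -> (forall i, B (v i - lin w (row i A))) -> qindep B v ->
  row_free A.
Proof.
move=> sB BvA vI; apply/inj_row_free => c cA; apply: vI.
have := lin_mul c sB BvA; rewrite cA.
have -> : lin w 0 = 0 by rewrite /lin big1 // => i _;
  rewrite mxE rmorph0 scale0r.
by rewrite subr0.
Qed.

Lemma qindep_leq Z B r s (v : 'I_r -> V) (w : 'I_s -> V) :
  subspace B -> (forall i, Z (v i)) -> qspan Z B w -> qindep B v -> (r <= s)%N.
Proof.
move=> sB Zv wS vI; have [A BA] := qspan_mx Zv wS.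
have /eqP <- := qindep_row_free sB BA vI.
exact: rank_leq_col.
Qed.

Lemma qdim_uniq Z B r s : subspace B -> qdim Z B r -> qdim Z B s -> r = s.
Proof.
move=> sB [v [Zv vS vI]] [w [Zw wS wI]].
by apply/eqP; rewrite eqn_leq (qindep_leq sB Zv wS vI) (qindep_leq sB Zw vS wI).
Qed.

Lemma qindep_span Z B r (v : 'I_r -> V) :
  subspace B -> qdim Z B r -> (forall i, Z (v i)) -> qindep B v ->
  qspan Z B v.
Proof.
move=> sB [w [Zw wS wI]] Zv vI; have [A BA] := qspan_mx Zv wS.
have uA : A \in unitmx by rewrite -row_free_unit; apply: qindep_row_free BA vI.
move=> z Zz; have [c Bc] := wS z Zz; exists (c *m invmx A).
have /(subspaceN sB) := lin_mul (c *m invmx A) sB BA.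
rewrite mulmxKV // opprB => /(subspaceD sB Bc).
by rewrite addrA subrK.
Qed.

Lemma qdim0 Z B : qdim Z B 0 -> forall z, Z z -> B z.
Proof.
case=> v [_ vS _] z /vS[c]; rewrite /lin big1 ?subr0 // => i; by case: i.
Qed.

Lemma qdim_gt0 Z B r : qdim Z B r -> (0 < r)%N -> exists2 z, Z z & ~ B z.
Proof.
case: r => // r [v [Zv _ vI]] _; exists (v ord0) => // Bv.
have /vI/rowP/(_ ord0) : B (lin v (delta_mx 0 ord0)).
  rewrite /lin (bigD1 ord0) //= mxE !eqxx rmorph1 scale1r big1 ?addr0 // => i i0.
  by rewrite mxE (negPf i0) andbF rmorph0 scale0r.
by rewrite !mxE !eqxx => /eqP; rewrite oner_eq0.
Qed.

Lemma qdim_ext Z Z' B B' r :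
  (forall z, Z z <-> Z' z) -> (forall z, B z <-> B' z) ->
  qdim Z B r -> qdim Z' B' r.
Proof.
move=> ZZ' BB' [v [Zv vS vI]]; exists v; split=> [i|z /ZZ'/vS[c Bc]|c /BB'].
- exact/ZZ'.
- by exists c; apply/BB'.
- exact: vI.
Qed.

Lemma qdim_exists Z B N (w : 'I_N -> V) :
  subspace Z -> subspace B -> qspan Z B w -> exists r, qdim Z B r.
Proof.
move=> sZ sB wS; apply: NNPP => nodim.
(* Without a dimension no independent family spans, so each can be enlarged by one vector, beyond
   the bound N. *)
suff ex r : exists2 v : 'I_r -> V, forall i, Z (v i) & qindep B v.
  have [v Zv vI] := ex N.+1.
  by have := qindep_leq sB Zv wS vI; rewrite ltnn.
elim: r => [|r [v Zv vI]].
  by exists (fun=> 0) => [[]//|c _]; apply/rowP => -[].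
have [z [Zz nz]] : exists z, Z z /\ ~ exists c, B (z - lin v c).
  apply: NNPP => nz; apply: nodim; exists r, v; split=> // z Zz.
  by apply: NNPP => h; apply: nz; exists z.
pose v' i := if unlift ord0 i is Some j then v j else z.
have lv' c : lin v' c = phi (c 0 0) *: z + lin v (\row_j c 0 (lift ord0 j)).
  rewrite /lin big_ord_recl /v' unlift_none; congr (_ + _).
  by apply: eq_bigr => j _; rewrite liftK mxE.
exists v' => [i|c]; first by rewrite /v'; case: unliftP => [j _|_].
rewrite lv'; have [c0 | c0] := eqVneq (c 0 0) 0.
  rewrite c0 rmorph0 scale0r add0r => /vI /rowP c0'; apply/rowP => i.
  by rewrite mxE; case: (unliftP ord0 i) => [j|] -> //; have := c0' j;
    rewrite !mxE.
move=> Bc; case: nz; exists (- ((c 0 0)^-1 *: (\row_j c 0 (lift ord0 j)))).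
have /= := subspaceZ (c 0 0)^-1 sB Bc.
by rewrite scalerDr scalerA -rmorphM mulVf // rmorph1 scale1r linN linZ opprK.
Qed.

End Subquotients.

Section SubquotientMaps.
Variable K : fieldType.

Lemma qdim_prod (S : nzRingType) (phi : {rmorphism K -> S}) (V W : lmodType S)
    (Z1 B1 : V -> Prop) (Z2 B2 : W -> Prop) r s :
  Z1 0 -> Z2 0 -> qdim phi Z1 B1 r -> qdim phi Z2 B2 s ->
  qdim phi (V := (V * W)%type) (fun u => Z1 u.1 /\ Z2 u.2)
       (fun u => B1 u.1 /\ B2 u.2) (r + s).
Proof.
move=> Z10 Z20 [v [Zv vS vI]] [w [Zw wS wI]].
pose f i : (V * W)%type :=
  match split i with inl j => (v j, 0) | inr j => (0, w j) end.
have lf c : lin phi f c = (lin phi v (lsubmx c), lin phi w (rsubmx c)).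
  rewrite /lin big_split_ord /=.
  have -> : \sum_(i < r) phi (c 0 (lshift s i)) *: f (lshift s i) =
            (\sum_i phi (lsubmx c 0 i) *: v i, 0).
    rewrite (eq_bigr (fun i => (phi (lsubmx c 0 i) *: v i, 0))); last first.
      move=> i _; rewrite /f; case: splitP => j /= eqj; last first.
        by have := ltn_ord i; rewrite eqj ltnNge leq_addr.
      by rewrite -(val_inj eqj) mxE; congr (_, _); rewrite /= scaler0.
    elim/big_ind2: _ => // u a u' b -> -> /=.
    by congr (_, _); rewrite /= addr0.
  have -> : \sum_(i < s) phi (c 0 (rshift r i)) *: f (rshift r i) =
            (0, \sum_i phi (rsubmx c 0 i) *: w i).
    rewrite (eq_bigr (fun i => (0, phi (rsubmx c 0 i) *: w i))); last first.
      move=> i _; rewrite /f; case: splitP => j /= eqj.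
        by have := ltn_ord j; rewrite -eqj ltnNge leq_addr.
      by move/addnI: eqj => eqj; rewrite -(val_inj eqj) mxE; congr (_, _);
        rewrite /= scaler0.
    elim/big_ind2: _ => // u a u' b -> -> /=.
    by congr (_, _); rewrite /= addr0.
  by congr (_, _); rewrite /= ?addr0 ?add0r.
exists f; split=> [i|[z1 z2] [/= /vS[c Bc] /wS[e Be]]|c].
- by rewrite /f; case: split => j /=.
- by exists (row_mx c e); rewrite lf row_mxKl row_mxKr.
- by rewrite lf => -[/= /vI c1 /wI c2]; rewrite -[c]hsubmxK c1 c2 row_mx0.
Qed.

(* A K-linear relation that matches Z / B with Z' / B' carries the dimension
   over; all isomorphisms below, connecting maps in particular, are given by
   relations of this kind. *)
Lemma qdim_rel (S S' : nzRingType) (phi : {rmorphism K -> S})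
    (phi' : {rmorphism K -> S'}) (V : lmodType S) (V' : lmodType S')
    (Z B : V -> Prop) (Z' B' : V' -> Prop) (Q : V -> V' -> Prop) r :
  subspace phi Z -> subspace phi' Z' ->
  Q 0 0 ->
  (forall c u u' v v', Q u u' -> Q v v' -> Q (phi c *: u + v) (phi' c *: u' + v')) ->
  (forall z, Z z -> exists2 z', Z' z' & Q z z') ->
  (forall z', Z' z' -> exists2 z, Z z & Q z z') ->
  (forall z z', Z z -> Z' z' -> Q z z' -> (B z <-> B' z')) ->
  qdim phi Z B r -> qdim phi' Z' B' r.
Proof.
move=> sZ sZ' Q0 QD ZZ' Z'Z BB' [v [Zv vS vI]].
have /fin_all_exists2[v' Zv' Qv] := fun i => ZZ' _ (Zv i).
have Ql c : Q (lin phi v c) (lin phi' v' c).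
  rewrite /lin; elim/big_ind2: _ => // [x1 x2 y1 y2 Q1 Q2|i _].
    have := QD 1 _ _ _ _ Q1 Q2; by rewrite !rmorph1 !scale1r.
  by have := QD (c 0 i) _ _ _ _ (Qv i) Q0; rewrite !addr0.
exists v'; split=> // [z' Zz'|c Bc].
  have [z Zz Qz] := Z'Z _ Zz'; have [c Bc] := vS z Zz; exists c.
  have /= Qzc := QD (-1) _ _ _ _ (Ql c) Qz.
  move: Qzc; rewrite !rmorphN !rmorph1 !scaleN1r ![- lin _ _ _ + _]addrC => Qzc.
  have Zc := subspaceB sZ Zz (subspace_lin c sZ Zv).
  have Zc' := subspaceB sZ' Zz' (subspace_lin c sZ' Zv').
  exact/(BB' _ _ Zc Zc' Qzc).
by apply/vI/(BB' _ _ _ _ (Ql c)) => //; apply: subspace_lin.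
Qed.

(** Links the difference of ranks in [fiber_homology_dim] to [qdim]: a basis of a complement of C in
    A represents a basis of the quotient. *)
Lemma qdim_mxrank m1 m2 g (A : 'M[K]_(m1, g)) (C : 'M[K]_(m2, g)) :
  (C <= A)%MS ->
  qdim (idfun : {rmorphism K -> K}) (fun v : 'rV[K]_g => (v <= A)%MS)
    (fun v => (v <= C)%MS) (\rank A - \rank C).
Proof.
move=> sCA; have rD : (\rank A - \rank C)%N = \rank (A :\: C)%MS.
  by rewrite -(mxrank_cap_compl A C) (capmx_idPr sCA) addKn.
rewrite rD; pose D := row_base (A :\: C)%MS.
have lD c : lin (idfun : {rmorphism K -> K}) (fun i => row i D) c = c *m D.
  by rewrite mulmx_sum_row.
exists (fun i => row i D); split=> [i|z zA|c].
- apply: (submx_trans (row_sub _ _)).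
  by rewrite eq_row_base; apply: diffmxSl.
- have : (z <= (A :\: C) + (A :&: C))%MS by rewrite addsmx_diff_cap_eq.
  case/sub_addsmxP => [[a b] /= ->].
  have : (a *m (A :\: C) <= D)%MS by rewrite eq_row_base submxMl.
  case/submxP => c ->; exists c; rewrite lD addrC addKr.
  by apply: (submx_trans (submxMl _ _)); apply: capmxSr.
- rewrite lD => cC; apply/eqP;
  rewrite -(mulmx_free_eq0 _ (row_base_free (A :\: C)%MS)).
  rewrite -submx0 -(capmx_diff A C) sub_capmx cC andbT.
  by apply: (submx_trans (submxMl _ _)); rewrite eq_row_base.
Qed.

End SubquotientMaps.

(** * The Koszul complex *)

Section Koszul.
Variables (R : comNzRingType) (l : nat -> R).

(* Lambda(R^r) (x) E; the pair (a, b) stands for a + e_r /\ b. *)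
Fixpoint kos (E : lmodType R) (r : nat) : lmodType R :=
  if r is r'.+1 then (kos E r' * kos E r')%type else E.

(** Encodes d(e_r /\ b) = l_r b - e_r /\ d b; the sign makes the square of d vanish. *)
Fixpoint kd (E : lmodType R) r : kos E r -> kos E r :=
  match r with
  | 0 => fun=> 0
  | r'.+1 => fun u => (kd u.1 + l r' *: u.2, - kd u.2)
  end.

(* Membership in Lambda^i(R^r) (x) P. *)
Fixpoint kin (E : lmodType R) (P : E -> Prop) r (i : nat) : kos E r -> Prop :=
  match r with
  | 0 => fun v => if i is 0 then P v else v = 0
  | r'.+1 => fun u => kin P i u.1 /\ (if i is i'.+1 then kin P i' u.2 else u.2 = 0)
  end.

Fixpoint kmap (E E' : lmodType R) (f : E -> E') r : kos E r -> kos E' r :=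
  match r with
  | 0 => f
  | r'.+1 => fun u => (kmap f u.1, kmap f u.2)
  end.

(** The inclusion of E as the part of exterior degree 0. *)
Fixpoint kemb (E : lmodType R) r (v : E) : kos E r :=
  if r is r'.+1 then (kemb r' v, 0) else v.

Section OneModule.
Variable E : lmodType R.
Implicit Types P Q : E -> Prop.

Lemma kd_linear r : linear (@kd E r).
Proof.
elim: r => [|r IH] a u v /=; first by rewrite scaler0 addr0.
rewrite !IH; congr (_, _) => /=; last by rewrite scalerN opprD.
by rewrite scalerDr scalerDr !scalerA mulrC addrACA.
Qed.

HB.instance Definition _ r :=
  GRing.isLinear.Build R (kos E r) (kos E r) _ (@kd E r) (@kd_linear r).

Lemma kdK r (u : kos E r) : kd (kd u) = 0.
Proof.
elim: r u => [|r IH] u //=; congr (_, _) => /=;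
  last by rewrite linearN /= IH !oppr0.
by rewrite linearD linearZ /= IH add0r scalerN addrN.
Qed.

Lemma kin_sub P Q r i (u : kos E r) :
  (forall v, P v -> Q v) -> kin P i u -> kin Q i u.
Proof.
move=> PQ; elim: r i u => [|r IH] [|i] u //=; first exact: PQ.
- by case=> /IH.
- by case=> /IH ? /IH.
Qed.

Lemma kin0 P r i : P 0 -> kin P i (0 : kos E r).
Proof. by move=> P0; elim: r i => [|r IH] [|i] //=; split=> //; apply: IH. Qed.

Lemma kinD P1 P2 Q r i (u v : kos E r) a :
  (forall v1 v2, P1 v1 -> P2 v2 -> Q (a *: v1 + v2)) ->
  kin P1 i u -> kin P2 i v -> kin Q i (a *: u + v).
Proof.
move=> PQ; elim: r i u v => [|r IH] [|i] u v /=.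
- exact: PQ.
- by move=> -> ->; rewrite scaler0 addr0.
- by move=> [u1 ->] [v1 ->]; split; [apply: IH | rewrite scaler0 addr0].
- by move=> [u1 u2] [v1 v2]; split; apply: IH.
Qed.

Lemma kinZ P Q r i (u : kos E r) a :
  (forall v, P v -> Q (a *: v)) -> kin P i u -> kin Q i (a *: u).
Proof.
move=> PQ; elim: r i u => [|r IH] [|i] u /=; first exact: PQ.
- by move=> ->; rewrite scaler0.
- by move=> [u1 ->]; split; [apply: IH | rewrite scaler0].
- by move=> [u1 u2]; split; apply: IH.
Qed.

Lemma kinN P r i (u : kos E r) :
  (forall v, P v -> P (- v)) -> kin P i u -> kin P i (- u).
Proof.
by move=> PN; rewrite -scaleN1r; apply: kinZ => v /PN; rewrite scaleN1r.
Qed.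

Lemma kinDD P r i (u v : kos E r) :
  (forall v1 v2, P v1 -> P v2 -> P (v1 + v2)) ->
  kin P i u -> kin P i v -> kin P i (u + v).
Proof.
move=> PD Pu Pv; rewrite -[u]scale1r; apply: kinD Pu Pv => v1 v2 P1 P2.
by rewrite scale1r; apply: PD.
Qed.

Lemma kin_gt P r i (u : kos E r) : (r < i)%N -> kin P i u -> u = 0.
Proof.
elim: r i u => [|r IH] [|i] u //= lt_ri; case: u => a b /= [/IH -> //].
  by move/IH ->.
exact: ltnW.
Qed.

Lemma kin_zero P r i (u : kos E r) : (forall v, P v -> v = 0) -> kin P i u -> u = 0.
Proof.
move=> P0; elim: r i u => [|r IH] [|i] u //=; first exact: P0.
  by case: u => a b /= [/IH -> ->].
by case: u => a b /= [/IH -> /IH ->].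
Qed.

Lemma kd_kin0 P r (u : kos E r) : kin P 0 u -> kd u = 0.
Proof.
elim: r u => [|r IH] u //=; case: u => a b /= [/IH -> ->].
by rewrite scaler0 addr0 linear0 oppr0.
Qed.

Lemma kd_kin P Q r i (u : kos E r) :
  (forall k v, (k < r)%N -> P v -> Q (l k *: v)) ->
  Q 0 -> (forall v, Q v -> Q (- v)) -> (forall v w, Q v -> Q w -> Q (v + w)) ->
  kin P i.+1 u -> kin Q i (kd u).
Proof.
move=> PQ Q0 QN QD; elim: r PQ i u => [|r IH] PQ i u /=; first by move=> _;
  case: i.
have PQ' k v : (k < r)%N -> P v -> Q (l k *: v) by move=> lt_kr; apply: PQ;
  apply: ltnW.
case=> u1 u2; split; last first.
  case: i u1 u2 => [|i] u1 u2; first by rewrite (kd_kin0 u2) oppr0.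
  by apply: kinN => //; apply: IH u2.
apply: kinDD => //; first exact: IH.
by apply: kinZ u2 => v; apply: PQ.
Qed.

Lemma kin_split P Q1 Q2 a r i (u : kos E r) :
  (forall v, P v -> exists v1 v2, [/\ Q1 v1, Q2 v2 & v = v1 + a *: v2]) ->
  kin P i u ->
  exists u1 u2, [/\ kin Q1 i u1, kin Q2 i u2 & u = u1 + a *: u2].
Proof.
move=> PQ; elim: r i u => [|r IH] [|i] u /=; first exact: PQ.
- by move=> ->; exists 0, 0; rewrite scaler0 addr0.
- case: u => u1 u2 /= [/IH[v1 [v2 [Q1v Q2v ->]]] ->].
  by exists (v1, 0), (v2, 0); split=> //; congr (_, _);
    rewrite /= scaler0 addr0.
- case: u => u1 u2 /= [/IH[v1 [v2 [Q1v Q2v ->]]] /IH[w1 [w2 [Q1w Q2w ->]]]].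
  by exists (v1, w1), (v2, w2); split.
Qed.

Lemma kin_colon P Q S a r i (u : kos E r) :
  (forall v, P v -> Q (a *: v) -> S v) ->
  kin P i u -> kin Q i (a *: u) -> kin S i u.
Proof.
move=> PQS; elim: r i u => [|r IH] [|i] u //=; first exact: PQS.
- by case=> u1 -> [v1 _]; split=> //; apply: IH.
- by case=> u1 u2 [v1 v2]; split; apply: IH.
Qed.

Lemma kembP P r (u : kos E r) : kin P 0 u <-> exists2 v, P v & u = kemb r v.
Proof.
elim: r u => [|r IH] u /=; first by split=> [Pu|[v Pv ->]//]; exists u.
case: u => a b /=; split=> [[/IH[v Pv ->] ->]|[v Pv [-> ->]]];
  first by exists v.
by split=> //; apply/IH; exists v.
Qed.

Lemma kemb_linear r : linear (@kemb E r).
Proof.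
elim: r => [|r IH] a u v //=; rewrite IH; congr (_, _).
by rewrite /= scaler0 addr0.
Qed.

HB.instance Definition _ r :=
  GRing.isLinear.Build R E (kos E r) _ (@kemb E r) (@kemb_linear r).

Lemma kemb_inj r : injective (@kemb E r).
Proof. by elim: r => [|r IH] u v //= [/IH]. Qed.

(** With its converse [kin1_kd], this translates between boundaries in exterior degree 0 and
    combinations of the l_k, which is how Koszul homology speaks about ideal membership. *)
Lemma kd_kin1 P r (u : kos E r) :
  kin P 1 u -> exists2 a : nat -> E, forall k, (k < r)%N -> P (a k) &
               kd u = kemb r (\sum_(k < r) l k *: a k).
Proof.
elim: r u => [|r IH] u /=.
  by move=> _; exists (fun=> 0) => //; rewrite big_ord0.
case: u => u1 u2 /= [/IH[a Pa ->] /kembP[v Pv ->]].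
exists (fun k => if k == r then v else a k) => [k lt_kr|].
  by case: eqVneq => // ne_kr; apply: Pa; rewrite ltn_neqAle ne_kr -ltnS.
rewrite big_ord_recr /= eqxx; congr (_, _); last first.
  by rewrite (@kd_kin0 P) ?oppr0 //; apply/kembP; exists v.
rewrite linearD linearZ /=; congr (kemb _ _ + _).
by apply: eq_bigr => k _; rewrite ltn_eqF.
Qed.

Lemma kin1_kd P r (a : nat -> E) :
  (forall k, (k < r)%N -> P (a k)) ->
  exists2 u : kos E r, kin P 1 u & kd u = kemb r (\sum_(k < r) l k *: a k).
Proof.
elim: r => [|r IH] Pa; first by exists 0 => //; rewrite big_ord0.
have [k lt_kr|u Pu du] := IH; first by apply: Pa; apply: ltnW.
have Pr : kin P 0 (kemb r (a r)) by apply/kembP; exists (a r) => //; apply: Pa.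
exists (u, kemb r (a r)) => //=.
by rewrite big_ord_recr /= linearD linearZ /= -du (kd_kin0 Pr) oppr0.
Qed.

(* Koszul homology vanishes in positive degree for a regular sequence; the
   graded pieces are the G c. *)
Lemma kos_acyclic (G : nat -> E -> Prop) r :
  (forall c, G c 0) -> (forall c v, G c v -> G c (- v)) ->
  (forall c v w, G c v -> G c w -> G c (v + w)) ->
  (forall c k v, (k < r)%N -> G c v -> G c.+1 (l k *: v)) ->
  (forall c k v (a : nat -> E), (k < r)%N -> G c.+1 v ->
     (forall j, (j < k)%N -> G c.+1 (a j)) -> l k *: v = \sum_(j < k) l j *: a j ->
     exists2 b : nat -> E, forall j, (j < k)%N -> G c (b j)
                         & v = \sum_(j < k) l j *: b j) ->
  forall c i (u : kos E r), kin (G c.+1) i.+1 u -> kd u = 0 ->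
  exists2 w, kin (G c) i.+2 w & u = kd w.
Proof.
move=> G0 GN GD; elim: r => [|r IH] Gl Greg c i u.
  by move=> /= -> _; exists 0.
have{}IH := IH (fun c k v lt_kr => Gl c k v (ltnW lt_kr))
   (fun c k v a lt_kr => Greg c k v a (ltnW lt_kr)).
case: u => a b [/= Ga Gb] [da db].
have{}db : kd b = 0 by rewrite -[LHS]opprK db oppr0.
(* The coefficient b of e_r is a cycle. In positive exterior degree induction bounds it; in degree 0
   the equation d a = - l_r b puts l_r b in the span of the earlier forms, and regularity cancels
   l_r. *)
have [g Gg def_b] : exists2 g, kin (G c) i.+1 g & b = kd g.
  case: i Ga Gb => [|i] Ga Gb; last exact: IH.
  have [v Gv def_b] := (kembP _ _).1 Gb.
  have [a' Ga' def_a] := kd_kin1 Ga.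
  have [||b' Gb' def_v] := Greg c r v (fun k => - a' k) (ltnSn r) Gv.
  - by move=> j /Ga'; apply: GN.
  - apply: (@kemb_inj r); rewrite linearZ /= -def_b.
    move/eqP: da; rewrite addrC addr_eq0 => /eqP ->; rewrite def_a -linearN.
    by rewrite -sumrN; congr kemb; apply: eq_bigr => j _; rewrite scalerN.
  by have [g Gg dg] := kin1_kd Gb'; exists g => //; rewrite dg -def_v.
(* The correction makes the first component a cycle: d(a + l_r g) = d a + l_r b = 0. *)
have [||h Gh def_h] := IH c i (a + l r *: g).
- by apply: kinDD => //; [apply: GD | apply: kinZ Gg => v; apply: Gl].
- by rewrite linearD linearZ /= -def_b.
exists (h, - g) => /=; first by split=> //; apply: kinN => //; apply: GN.
by rewrite scalerN linearN /= opprK -def_b -def_h addrK.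
Qed.

End OneModule.

Section Map.
Variables (E E' : lmodType R) (f : {linear E -> E'}).

Lemma kmap_linear r : linear (@kmap E E' f r).
Proof.
elim: r => [|r IH] a u v; first exact: linearP.
by rewrite /= !IH.
Qed.

HB.instance Definition _ r :=
  GRing.isLinear.Build R (kos E r) (kos E' r) _ (@kmap E E' f r) (@kmap_linear r).

Lemma kmap_kd r (u : kos E r) : kmap f (kd u) = kd (kmap f u).
Proof.
elim: r u => [|r IH] u; first exact: linear0.
by rewrite /= !(linearD, linearN, linearZ) /= !IH.
Qed.

Lemma kmap_kin (P : E -> Prop) (Q : E' -> Prop) r i (u : kos E r) :
  (forall v, P v -> Q (f v)) -> kin P i u -> kin Q i (kmap f u).
Proof.
move=> PQ; elim: r i u => [|r IH] [|i] u /=; first exact: PQ.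
- by move=> ->; rewrite linear0.
- by case=> u1 ->; split; [apply: IH | rewrite linear0].
- by case=> u1 u2; split; apply: IH.
Qed.

Lemma kmap_lift (P : E -> Prop) (Q : E' -> Prop) r i (w : kos E' r) :
  (forall v, Q v -> exists2 u, P u & f u = v) -> kin Q i w ->
  exists2 u, kin P i u & kmap f u = w.
Proof.
move=> QP; elim: r i w => [|r IH] [|i] w /=; first exact: QP.
- by move=> ->; exists 0 => //; rewrite linear0.
- case: w => a b /= [/IH[u Pu <-] ->]; exists (u, 0) => //=.
  by rewrite linear0.
- by case: w => a b /= [/IH[u Pu <-] /IH[v Pv <-]]; exists (u, v).
Qed.

Lemma kmap_ker (P Q : E -> Prop) r i (u : kos E r) :
  (forall v, P v -> f v = 0 -> Q v) -> kin P i u -> kmap f u = 0 -> kin Q i u.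
Proof.
move=> PQ; elim: r i u => [|r IH] [|i] u //=; first exact: PQ.
- by case=> u1 -> [f1 _]; split=> //; apply: IH.
- by case=> u1 u2 [f1 f2]; split; apply: IH.
Qed.

End Map.
End Koszul.

Section KoszulDimension.
Variables (K : fieldType) (R : comNzRingType) (phi : {rmorphism K -> R}).
Variable E : lmodType R.

Lemma subspace_kin (P : E -> Prop) r i :
  subspace phi P -> subspace phi (@kin R E P r i).
Proof. by case=> P0 cP; split=> [|c u v];
  [apply: kin0 | apply: kinD => u' v'; apply: cP]. Qed.

(** The recursion of [kos] into pairs is Pascal's rule. *)
Lemma qdim_kin (Z B : E -> Prop) s r i :
  Z 0 -> qdim phi Z B s -> qdim phi (@kin R E Z r i) (kin B i) ('C(r, i) * s).
Proof.
move=> Z0 dZ.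
have d0 (V : lmodType R) : qdim phi (fun u : V => u = 0) (fun u => u = 0) 0.
  exists (fun=> 0); split=> // [u ->|c _]; last by apply/rowP => -[].
  by exists 0; rewrite /lin big1 ?subr0 // => -[].
elim: r i => [|r IH] [|i]; first by rewrite mul1n.
- by rewrite mul0n; apply: d0.
- have := qdim_prod (kin0 r 0 Z0) (erefl 0) (IH 0) (d0 (kos E r)).
  by rewrite addn0 !bin0.
- by rewrite binS mulnDl; apply: qdim_prod (IH _) (IH _); apply: kin0.
Qed.

End KoszulDimension.

(** * Linear forms in polynomial rings *)

Section Polynomials.
Variables (K : fieldType) (n : nat).
Local Notation R := {mpoly K[n]}.
Implicit Types (f g : R) (m : 'X_{1..n}).

Definition is_ideal (J : R -> Prop) : Prop :=
  J 0 /\ forall a f g, J f -> J g -> J (a * f + g).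

Lemma is_idealM J a f : is_ideal J -> J f -> J (a * f).
Proof. by case=> J0 JD Jf; rewrite -[a * f]addr0; apply: JD. Qed.

Lemma is_idealD J f g : is_ideal J -> J f -> J g -> J (f + g).
Proof. by case=> J0 JD Jf Jg; rewrite -[f]mul1r; apply: JD. Qed.

Lemma is_idealB J f g : is_ideal J -> J f -> J g -> J (f - g).
Proof. by case=> J0 JD Jf Jg; rewrite addrC -mulN1r; apply: JD. Qed.

Lemma is_idealZ J c f : is_ideal J -> J f -> J (c *: f).
Proof. by move=> iJ Jf; rewrite -mul_mpolyC; apply: is_idealM. Qed.

Lemma is_ideal_sum J (T : eqType) (s : seq T) (P : pred T) (F : T -> R) :
  is_ideal J -> (forall i, i \in s -> P i -> J (F i)) -> J (\sum_(i <- s | P i) F i).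
Proof.
move=> iJ JF; rewrite big_seq_cond.
elim/big_ind: _ => [|f g|i /andP[si Pi]]; last exact: JF.
- by case: iJ.
- exact: is_idealD.
Qed.

Lemma is_ideal_lin (l : nat -> R) r :
  is_ideal (fun f => exists b : nat -> R, f = \sum_(j < r) l j * b j).
Proof.
split=> [|a f g [b ->] [b' ->]].
  by exists (fun=> 0); rewrite big1 // => j _; rewrite mulr0.
exists (fun j => a * b j + b' j); rewrite mulr_sumr -big_split /=.
by apply: eq_bigr => j _; rewrite mulrDr mulrCA.
Qed.

(** Used to decide membership in ideals generated by linear forms: if the substitution t also kills
    J, then J is exactly its kernel. *)
Lemma comp_mpoly_congr (J : R -> Prop) (t : n.-tuple R) f :
  is_ideal J -> (forall i, J ('X_i - tnth t i)) -> J (f - (f \mPo t)).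
Proof.
move=> iJ Jt; rewrite {1}[f]mpolyE comp_mpolyEX -sumrB.
apply: is_ideal_sum => // m _ _; rewrite -scalerBr; apply: is_idealZ => //.
rewrite comp_mpolyX mpolyXE_id.
elim/big_rec2: _ => [|i a b _ Jab]; first by rewrite subrr; case: iJ.
have -> : 'X_i ^+ m i * b - tnth t i ^+ m i * a =
   ('X_i ^+ m i - tnth t i ^+ m i) * b + tnth t i ^+ m i * (b - a).
  by rewrite mulrBl mulrBr addrA subrK.
apply: is_idealD; [done | | exact: is_idealM].
rewrite mulrC; apply: is_idealM => //; rewrite subrXX mulrC.
exact: is_idealM.
Qed.

Lemma mcoeff_pihomog d f m :
  (pihomog mdeg d f)@_m = if mdeg m == d then f@_m else 0.
Proof.
case: eqP => [dm|/eqP dm]; last first.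
  by apply: dhomog_nemf_coeff dm; apply: pihomogP.
have lt_d : (d < mmeasure mdeg f + d.+1)%N by rewrite addnS ltnS leq_addl.
apply/esym; rewrite {1}(pihomog_partitionE (leq_addr d.+1 (mmeasure mdeg f))).
rewrite [LHS](raddf_sum (mcoeff m)) /= [LHS](bigD1 (Ordinal lt_d)) //=.
rewrite [X in _ + X]big1 ?addr0 // => i ne_id.
apply: (dhomog_nemf_coeff (pihomogP mdeg i f)); rewrite /= dm.
by apply: contraNneq ne_id => def_d; apply/eqP/val_inj.
Qed.

Lemma lin_formE (x : R) : x \is 1.-homog -> x = \sum_i x@_U_(i) *: 'X_i.
Proof.
move=> x1; apply/mpolyP => m; rewrite raddf_sum /=.
have [/mdeg1P[i /eqP ->]|dm] := boolP (mdeg m == 1%N).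
  rewrite (bigD1 i) //= mcoeffZ mcoeffXU eqxx mulr1 big1 ?addr0 // => j ne_ji.
  by rewrite mcoeffZ mcoeffXU (negPf ne_ji) mulr0.
rewrite (dhomog_nemf_coeff x1 dm) big1 // => i _; rewrite mcoeffZ mcoeffX.
by case: eqP => [mU|_]; rewrite ?mulr0 //; rewrite -mU mdeg1 in dm.
Qed.

Lemma lin_form_neq0 (x : R) : x \is 1.-homog -> x != 0 -> exists p, x@_U_(p) != 0.
Proof.
move=> /lin_formE xE x0; apply/existsP; apply: contraNT x0 => /existsPn x0.
by rewrite xE big1 // => i _; have /negPn/eqP -> := x0 i; rewrite scale0r.
Qed.

Lemma is_ideal_const0 J f :
  is_ideal J -> (forall i, J 'X_i) -> f@_0%MM = 0 -> J f.
Proof.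
move=> iJ JX f0; pose t : n.-tuple R := [tuple 0 | i < n];
  have := @comp_mpoly_congr J t f iJ.
have -> : (f \mPo t) = 0.
  rewrite comp_mpolyEX big_seq big1 // => m fm; rewrite comp_mpolyX.
  have [i mi] : exists i, m i != 0%N.
    apply/existsP; apply: contraTT fm => /existsPn m0.
    rewrite mcoeff_msupp negbK; suff -> : m = 0%MM by rewrite f0.
    by apply/mnmP => i; rewrite mnm0E; apply/eqP/negPn/m0.
  by rewrite (bigD1 i) //= tnth_mktuple expr0n (negPf mi) mul0r scaler0.
by rewrite subr0; apply=> i; rewrite tnth_mktuple subr0.
Qed.

Lemma mpolyX_const0 (i : 'I_n) : ('X_i : R)@_0%MM = 0.
Proof. by rewrite mcoeffX -mdeg_eq0 mdeg1. Qed.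

Lemma mcoeff0M f g : (f * g)@_0%MM = f@_0%MM * g@_0%MM.
Proof. exact: rmorphM. Qed.

Lemma irrelevantP f : irrelevant f <-> f@_0%MM = 0.
Proof.
split=> [[g ->]|f0].
  by rewrite raddf_sum big1 //= => i _; rewrite mcoeff0M mpolyX_const0 mulr0.
apply: is_ideal_const0 f0 => [|i].
  split=> [|a g h [u ->] [v ->]].
    by exists (fun=> 0); rewrite big1 // => i _; rewrite mul0r.
  exists (fun i => a * u i + v i); rewrite mulr_sumr -big_split.
  by apply: eq_bigr => i _ /=; rewrite mulrDl mulrA.
exists (fun j => (j == i)%:R); rewrite (bigD1 i) //= eqxx mul1r big1 ?addr0 //.
by move=> j /negPf ->; rewrite mul0r.
Qed.

End Polynomials.

(** * Linear coordinates with a given form x in last place *)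

Section RegularSequence.
Variables (K : fieldType) (n : nat).
Local Notation R := {mpoly K[n.+1]}.
Variables (x : R) (p : 'I_n.+1).
Hypotheses (x1 : x \is 1.-homog) (xp : x@_U_(p) != 0).

(** As x has a nonzero coefficient at X_p, it can replace X_p as a coordinate; the other variables
    come first, in the order given by [lift p]. *)
Definition vars_then (k : nat) : R :=
  if insub k is Some j then 'X_(lift p (j : 'I_n)) else x.

Lemma vars_then_lt (k : 'I_n) : vars_then k = 'X_(lift p k).
Proof. by rewrite /vars_then valK. Qed.

Lemma vars_then_last : vars_then n = x.
Proof. by rewrite /vars_then insubF ?ltnn. Qed.

Lemma vars_then_homog k : vars_then k \is 1.-homog.
Proof.
by rewrite /vars_then; case: insubP => [j _ _|_] //; rewrite dhomogX /= mdeg1.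
Qed.

(** A substitution that kills the first k forms maps into the domain R and has their ideal as
    kernel; it does not kill the next form, which can therefore be cancelled. *)
Lemma vars_then_regular k (v : R) (a : nat -> R) : (k < n.+1)%N ->
  vars_then k * v = \sum_(j < k) vars_then j * a j ->
  exists b : nat -> R, v = \sum_(j < k) vars_then j * b j.
Proof.
move=> le_kn def_v.
pose J (f : R) := exists b : nat -> R, f = \sum_(j < k) vars_then j * b j.
have iJ : is_ideal J := is_ideal_lin vars_then k.
pose t : n.+1.-tuple R := [tuple if unlift p i is Some j then
                   if (j < k)%N then 0 else 'X_i : R else 'X_i | i < n.+1].
have Jt (f : R) : J (f - (f \mPo t)).
  apply: comp_mpoly_congr => // i; rewrite tnth_mktuple.
  case: unliftP => [j ->|_]; last by rewrite subrr; case: iJ.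
  case: ifP => lt_jk; last by rewrite subrr; case: iJ.
  rewrite subr0 -vars_then_lt; exists (fun e : nat => (e == j)%:R).
  rewrite (bigD1 (Ordinal lt_jk)) //= eqxx mulr1 big1 ?addr0 // => e ne_ej.
  by rewrite (negPf (_ : (val e != j))) ?mulr0.
have t0 (j : 'I_k) : (vars_then j \mPo t) = 0.
  have lt_jn : (j < n)%N by apply: leq_trans (ltn_ord j) _; rewrite -ltnS.
  rewrite (vars_then_lt (Ordinal lt_jn)) comp_mpolyXU -tnth_nth tnth_mktuple.
  by rewrite liftK /= ltn_ord.
have tk : (vars_then k \mPo t) != 0.
  move: le_kn; rewrite ltnS leq_eqVlt => /orP[/eqP -> |lt_kn].
    rewrite vars_then_last (lin_formE x1) raddf_sum /=.
    apply: contra_neq xp => /(congr1 (mcoeff U_(p)%MM)).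
    rewrite raddf_sum (bigD1 p) //= mcoeff0 comp_mpolyZ comp_mpolyXU -tnth_nth.
    rewrite tnth_mktuple unlift_none mcoeffZ mcoeffXU eqxx mulr1 big1 ?addr0 //.
    move=> i ne_ip; rewrite comp_mpolyZ comp_mpolyXU -tnth_nth tnth_mktuple.
    have Xp : 'X_i@_U_(p) = 0 :> K by rewrite mcoeffXU (negPf ne_ip).
    by rewrite mcoeffZ; case: unlift => [j|]; rewrite ?Xp ?mulr0 //; case: ifP;
      rewrite ?Xp ?mcoeff0 ?mulr0.
  rewrite (vars_then_lt (Ordinal lt_kn)) comp_mpolyXU -tnth_nth tnth_mktuple.
  rewrite liftK /= ltnn; apply/eqP => /(congr1 (mcoeff U_(lift p (Ordinal lt_kn))%MM)).
  by rewrite mcoeffXU eqxx mcoeff0; apply/eqP; rewrite oner_eq0.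
have : (v \mPo t) = 0.
  move/(congr1 (comp_mpoly t)): def_v; rewrite rmorphM /= rmorph_sum /=.
  under eq_bigr => j _ do rewrite rmorphM /= t0 mul0r.
  by rewrite big1 // => /eqP; rewrite mulf_eq0 (negPf tk) => /eqP.
by move=> tv; have := Jt v; rewrite tv subr0.
Qed.

Lemma vars_then_gen (f : R) : f@_0%MM = 0 ->
  exists b : nat -> R, f = \sum_(j < n.+1) vars_then j * b j.
Proof.
pose J (f : R) := exists b : nat -> R, f = \sum_(j < n.+1) vars_then j * b j.
have iJ : is_ideal J := is_ideal_lin vars_then n.+1.
have Jl (j : 'I_n.+1) : J (vars_then j).
  exists (fun e : nat => (e == j)%:R).
  rewrite (bigD1 j) //= eqxx mulr1 big1 ?addr0 // => e ne_ej.
  by rewrite (negPf (_ : (val e != j))) ?mulr0.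
have JX i : i != p -> J 'X_i.
  case: (unliftP p i) => [j ->|->]; last by rewrite eqxx.
  by rewrite -vars_then_lt => _; apply: (Jl (widen_ord (leqnSn n) j)).
apply: (@is_ideal_const0 _ _ J) => // i; have [-> |] := eqVneq i p;
  last exact: JX.
have -> : 'X_p = (x@_U_(p))^-1 *: (x - \sum_(i | i != p) x@_U_(i) *: 'X_i).
  by rewrite {2}(lin_formE x1) (bigD1 p) //= addrK scalerA mulVf // scale1r.
apply: is_idealZ => //; apply: is_idealB => //.
  by have := Jl ord_max; rewrite /= vars_then_last.
by apply: is_ideal_sum => // j _ ne_jp; apply: is_idealZ => //; apply: JX.
Qed.

(* Substituting X_p - x / x_p for X_p identifies R / xR with a subring of R. *)
Lemma lin_form_prime (f g : R) :
  (exists h, f * g = x * h) -> (exists h, f = x * h) \/ (exists h, g = x * h).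
Proof.
pose J (f : R) := exists h, f = x * h.
have iJ : is_ideal J.
  split=> [|a u v [h ->] [h' ->]]; first by exists 0; rewrite mulr0.
  by exists (a * h + h'); rewrite mulrDr mulrCA.
pose t : n.+1.-tuple R := [tuple if i == p then 'X_i - (x@_U_(p))^-1 *: x else 'X_i : R | i < n.+1].
have Jt (f' : R) : J (f' - (f' \mPo t)).
  apply: comp_mpoly_congr => // i; rewrite tnth_mktuple.
  case: ifP => _; last by rewrite subrr; case: iJ.
  by rewrite opprB addrC subrK; apply: is_idealZ => //; exists 1; rewrite mulr1.
have xt : (x \mPo t) = 0.
  rewrite {1}(lin_formE x1) raddf_sum (bigD1 p) //= comp_mpolyZ comp_mpolyXU.
  rewrite -tnth_nth tnth_mktuple eqxx.
  rewrite (eq_bigr (fun i => x@_U_(i) *: 'X_i)); last first.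
    move=> i ne_ip; rewrite comp_mpolyZ comp_mpolyXU.
    by rewrite -tnth_nth tnth_mktuple (negPf ne_ip).
  rewrite scalerBr scalerA divff // scale1r addrAC; apply/eqP; rewrite subr_eq0.
  by rewrite [X in _ == X](lin_formE x1) [X in _ == X](bigD1 p) /=.
case=> h /(congr1 (comp_mpoly t)); rewrite !rmorphM /= xt mul0r => /eqP.
rewrite mulf_eq0 => /orP[] /eqP ft; [left; have := Jt f | right; have := Jt g];
  by rewrite ft subr0.
Qed.

End RegularSequence.

(** * Graded free modules *)

Section GradedFree.
Variables (K : fieldType) (n : nat).
Local Notation R := {mpoly K[n]}.
Local Notation phi := (@mpolyC n K : {rmorphism K -> R}).

(* The piece of degree c - 1, so that the piece with index 0 vanishes. *)
Definition gpiece g (dg : 'I_g -> nat) (c : nat) (u : 'rV[R]_g) : Prop :=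
  forall q m, (u 0 q)@_m != 0 -> (mdeg m + dg q).+1 = c.

(** Projection onto [gpiece dg c]. The guard is for generators of degree at least c, where the
    truncated subtraction would select constants by mistake. *)
Definition gcomp g (dg : 'I_g -> nat) (c : nat) (u : 'rV[R]_g) : 'rV[R]_g :=
  \row_q if (dg q < c)%N then pihomog mdeg (c.-1 - dg q) (u 0 q) else 0.

Definition homog_mx g h (dg : 'I_g -> nat) (dh : 'I_h -> nat)
    (D : 'M[R]_(g, h)) : Prop :=
  forall p q m, (D p q)@_m != 0 -> (mdeg m + dh q = dg p)%N.

Lemma row_coeffP g (u v : 'rV[R]_g) :
  (forall q m, (u 0 q)@_m = (v 0 q)@_m) -> u = v.
Proof. by move=> uv; apply/rowP => q; apply/mpolyP => m. Qed.

Lemma mcoeff_gcomp g (dg : 'I_g -> nat) c u q m :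
  (gcomp dg c u 0 q)@_m = if (mdeg m + dg q).+1 == c then (u 0 q)@_m else 0.
Proof.
rewrite mxE; case: ltnP => dq; last first.
  by rewrite mcoeff0; case: eqP => // ec; lia.
rewrite mcoeff_pihomog; case: eqP => ec; case: eqP => // ec'; lia.
Qed.

Lemma gcomp_gpiece g (dg : 'I_g -> nat) c u : gpiece dg c (gcomp dg c u).
Proof. by move=> q m; rewrite mcoeff_gcomp; case: ifP => [/eqP//|_];
  rewrite eqxx. Qed.
Arguments gcomp_gpiece {g} dg c u.

Lemma gcomp_id g (dg : 'I_g -> nat) c u : gpiece dg c u -> gcomp dg c u = u.
Proof.
move=> cu; apply: row_coeffP => q m; rewrite mcoeff_gcomp.
case: eqP => // ne; apply/eqP; rewrite eq_sym; apply/negPn/negP => /cu.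
exact: ne.
Qed.

Lemma gcomp_neq g (dg : 'I_g -> nat) c c' u :
  gpiece dg c u -> c != c' -> gcomp dg c' u = 0.
Proof.
move=> cu ne_cc'; apply: row_coeffP => q m; rewrite mcoeff_gcomp mxE mcoeff0.
case: eqP => // ec'; apply/eqP/negPn/negP => /cu ec.
by rewrite -ec -ec' eqxx in ne_cc'.
Qed.

Lemma gcompB g (dg : 'I_g -> nat) c : additive (gcomp dg c).
Proof.
move=> u v; apply: row_coeffP => q m; rewrite mcoeff_gcomp !mxE !mcoeffB.
have := mcoeff_gcomp dg c u q m; have := mcoeff_gcomp dg c v q m.
rewrite !mxE => -> ->; by case: eqP => _; rewrite ?subr0.
Qed.

HB.instance Definition _ g (dg : 'I_g -> nat) c :=
  GRing.isAdditive.Build 'rV[R]_g 'rV[R]_g (gcomp dg c) (gcompB dg c).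

Lemma gcomp_sum g (dg : 'I_g -> nat) u :
  exists N, u = \sum_(c < N) gcomp dg c u.
Proof.
exists (\max_q (msize (u ord0 q) + dg q)).+1; apply: row_coeffP => q m.
rewrite summxE raddf_sum /=; have [u0|um] := eqVneq ((u 0 q)@_m) 0.
  by rewrite u0 big1 // => c _; rewrite mcoeff_gcomp u0 if_same.
have lt_c : ((mdeg m + dg q).+1 < (\max_q (msize (u ord0 q) + dg q)).+1)%N.
  rewrite ltnS; apply: leq_trans (leq_bigmax q).
  by rewrite -addSn leq_add2r msize_mdeg_lt // mcoeff_msupp.
rewrite (bigD1 (Ordinal lt_c)) //= mcoeff_gcomp eqxx big1 ?addr0 // => c ne_c.
rewrite mcoeff_gcomp; case: eqP => // ec; case/eqP: ne_c.
exact: val_inj.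
Qed.

(** Serves two kinds of maps: homogeneous matrices, with s the identity, and multiplication by a
    linear form, with s the successor. *)
Lemma gcomp_morph g h (dg : 'I_g -> nat) (dh : 'I_h -> nat)
    (f : {additive 'rV[R]_g -> 'rV[R]_h}) (s : nat -> nat) c u :
  injective s -> (forall e v, gpiece dg e v -> gpiece dh (s e) (f v)) ->
  gcomp dh (s c) (f u) = f (gcomp dg c u).
Proof.
move=> s_inj fs; have [N uE] := gcomp_sum dg u.
(* Zero components are added to the decomposition of [u] so that the index c occurs in it. *)
have [M lt_cM le_NM] : exists2 M, (c < M)%N & (N <= M)%N.
  by exists (maxn c.+1 N); rewrite ?leq_maxl ?leq_maxr.
have {}uE : u = \sum_(e < M) gcomp dg e u.
  rewrite [LHS]uE (big_ord_widen _ (fun e => gcomp dg e u) le_NM).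
  rewrite [RHS](bigID (fun e : 'I_M => (e < N)%N)) /= [X in _ + X]big1 ?addr0 //.
  move=> e; rewrite -leqNgt => le_Ne; rewrite uE raddf_sum big1 //= => e' _.
  apply: (gcomp_neq (gcomp_gpiece dg e' u)).
  by rewrite neq_ltn (leq_trans (ltn_ord e') le_Ne).
rewrite {1}uE !raddf_sum /= (bigD1 (Ordinal lt_cM)) //=.
rewrite (gcomp_id (fs _ _ (gcomp_gpiece _ _ _))) big1 ?addr0 // => e ne_ec.
apply: gcomp_neq (fs _ _ (gcomp_gpiece _ _ _)) _.
by apply: contra_neq ne_ec => /s_inj ec; apply: val_inj.
Qed.

Lemma gpiece_subspace g (dg : 'I_g -> nat) c : subspace phi (gpiece dg c).
Proof.
split=> [q m|a u v cu cv q m]; first by rewrite mxE mcoeff0 eqxx.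
rewrite !mxE mcoeffD mcoeffCM => nz.
have [u0|/cu//] := eqVneq ((u 0 q)@_m) 0.
by apply: cv; rewrite u0 mulr0 add0r in nz.
Qed.

Lemma gpiece0 g (dg : 'I_g -> nat) u : gpiece dg 0 u -> u = 0.
Proof.
move=> c0; apply: row_coeffP => q m; rewrite mxE mcoeff0.
by apply/eqP/negPn/negP => /c0.
Qed.

Lemma gpieceZ g (dg : 'I_g -> nat) c (l : R) u :
  l \is 1.-homog -> gpiece dg c u -> gpiece dg c.+1 (l *: u).
Proof.
move=> l1 cu q m; rewrite mxE -mcoeff_msupp => /msuppM_le/allpairsP[[m1 m2] /=].
case=> /(dhomog_mf l1) /= d1; rewrite mcoeff_msupp => /cu <- ->.
by rewrite mdegD d1.
Qed.

Lemma gpiece_mul g h (dg : 'I_g -> nat) (dh : 'I_h -> nat) D c u :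
  homog_mx dg dh D -> gpiece dg c u -> gpiece dh c (u *m D).
Proof.
move=> hD cu q m; rewrite mxE -mcoeff_msupp => /msupp_sum_le/flatten_mapP[p _].
move=> /msuppM_le/allpairsP[[m1 m2] /=]; rewrite !mcoeff_msupp.
by case=> /cu <- /hD <- ->; rewrite mdegD addnA.
Qed.

Lemma gpiece_span g (dg : 'I_g -> nat) c :
  exists N (w : 'I_N -> 'rV[R]_g),
    forall z, gpiece dg c z -> exists a, z = lin phi w a.
Proof.
pose T := ('X_{1..n < c} * 'I_g)%type.
pose w (t : T) : 'rV[R]_g := 'X_[bmnm t.1] *: delta_mx 0 t.2.
exists #|{: T}|, (fun i => w (enum_val i)) => z cz.
exists (\row_i (z 0 (enum_val i).2)@_(bmnm (enum_val i).1)).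
rewrite /lin (reindex (@enum_rank T)) /=;
  last exact: onW_bij (@enum_rank_bij _).
under eq_bigr => t _ do rewrite mxE enum_rankK scalerA mul_mpolyC.
rewrite -(pair_bigA _ (fun (m : 'X_{1..n < c}) q => ((z 0 q)@_m *: 'X_[m]) *: delta_mx 0 q)) /=.
rewrite exchange_big /= {1}[z]row_sum_delta; apply: eq_bigr => q _.
rewrite -scaler_suml; congr (_ *: _); apply: mpolywE.
rewrite msizeE; apply/bigmax_leqP_seq => m; rewrite mcoeff_msupp => /cz <- _.
by rewrite ltnS leq_addr.
Qed.

Lemma gpiece_qdim g (dg : 'I_g -> nat) c (Z B : 'rV[R]_g -> Prop) :
  subspace phi Z -> subspace phi B -> (forall z, Z z -> gpiece dg c z) ->
  exists r, qdim phi Z B r.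
Proof.
move=> sZ sB cZ; have [N [w wS]] := gpiece_span dg c.
apply: (qdim_exists (w := w)) => // z /cZ/wS[a ->]; exists a.
by rewrite subrr; case: sB.
Qed.

Section LinearForms.
Variable l : nat -> R.
Hypothesis l1 : forall k, l k \is 1.-homog.
Hypothesis lreg : forall k (v : R) (a : nat -> R), (k < n)%N ->
  l k * v = \sum_(j < k) l j * a j ->
  exists b : nat -> R, v = \sum_(j < k) l j * b j.
Hypothesis lgen : forall f : R, f@_0%MM = 0 ->
  exists b : nat -> R, f = \sum_(j < n) l j * b j.

(** Coefficients found entry by entry need not be homogeneous; projecting the whole identity to one
    piece makes them so. *)
Lemma row_lin_sum g (dg : 'I_g -> nat) c (u : 'rV[R]_g) r :
  gpiece dg c.+1 u ->
  (forall q, exists b : nat -> R, u 0 q = \sum_(j < r) l j * b j) ->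
  exists2 b : nat -> 'rV[R]_g, forall j, gpiece dg c (b j)
    & u = \sum_(j < r) l j *: b j.
Proof.
move=> cu /fin_all_exists[b ub].
exists (fun j => gcomp dg c (\row_q b q j)) => [j|]; first exact: gcomp_gpiece.
rewrite -[LHS](gcomp_id cu).
have -> : u = \sum_(j < r) l j *: (\row_q b q j).
  apply/rowP => q; rewrite ub summxE; apply: eq_bigr => j _.
  by rewrite !mxE.
rewrite raddf_sum /=; apply: eq_bigr => j _.
apply: (@gcomp_morph _ _ dg dg (GRing.scale (l j)) succn) => [|e v].
  exact: succn_inj.
exact: gpieceZ.
Qed.

Lemma row_gen g (dg : 'I_g -> nat) c (u : 'rV[R]_g) :
  gpiece dg c.+1 u -> (forall q, (u 0 q)@_0%MM = 0) ->
  exists2 b : nat -> 'rV[R]_g, forall j, gpiece dg c (b j)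
    & u = \sum_(j < n) l j *: b j.
Proof. by move=> cu u0; apply: row_lin_sum cu _ => q; apply: lgen. Qed.

Lemma row_acyclic g (dg : 'I_g -> nat) c i (u : kos 'rV[R]_g n) :
  kin (gpiece dg c.+1) i.+1 u -> kd l u = 0 ->
  exists2 w, kin (gpiece dg c) i.+2 w & u = kd l w.
Proof.
apply: kos_acyclic => {c i u} [c|c v|c v w|c k v _|c k v a lt_kn cv _ def_v].
- by case: (gpiece_subspace dg c).
- exact: subspaceN (gpiece_subspace dg c).
- exact: subspaceD (gpiece_subspace dg c).
- exact: gpieceZ.
have [q|b cb ->] := row_lin_sum (r := k) cv; last by exists b.
apply: (lreg (a := fun j => a j 0 q)) => //.
move/rowP/(_ q): def_v; rewrite mxE summxE => ->.
by apply: eq_bigr => j _; rewrite mxE.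
Qed.

End LinearForms.

End GradedFree.

Arguments gpiece_subspace {K n g} dg c.
Arguments gcomp_gpiece {K n g} dg c u.

(** * Betti numbers as Koszul homology *)

Section Homology.
Variables (K : fieldType) (n : nat).
Local Notation R := {mpoly K[n]}.
Local Notation phi := (@mpolyC n K : {rmorphism K -> R}).

Local Notation gsub := (@gpiece_subspace K n _).

Variable l : nat -> R.
Hypothesis l1 : forall k, l k \is 1.-homog.
Hypothesis lreg : forall k (v : R) (a : nat -> R), (k < n)%N ->
  l k * v = \sum_(j < k) l j * a j ->
  exists b : nat -> R, v = \sum_(j < k) l j * b j.
Hypothesis lgen : forall f : R, f@_0%MM = 0 ->
  exists b : nat -> R, f = \sum_(j < n) l j * b j.

(* HZ M i c / HB M i c is Tor_(i+1)(E / M, K), with E the ambient free module,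
   in internal degree i + c; it agrees with Tor_i(M, K) if i > 0 or M lies
   in mE. *)
Definition HZ g (dg : 'I_g -> nat) (M : nat -> 'rV[R]_g -> Prop) i c
    (w : kos 'rV[R]_g n) : Prop :=
  kin (M c.+1) i w /\ exists2 e, kin (gpiece dg c) i.+1 e & w = kd l e.

Definition HB g (M : nat -> 'rV[R]_g -> Prop) i c (w : kos 'rV[R]_g n) : Prop :=
  exists2 e, kin (M c) i.+1 e & w = kd l e.

(** The bound is uniform in i because passing to a syzygy module shifts i by one. *)
Definition kos_fin g (M : nat -> 'rV[R]_g -> Prop) : Prop :=
  exists C, forall c i (w : kos 'rV[R]_g n),
    (C <= c)%N -> kin (M c.+1) i w -> kd l w = 0 -> HB M i c w.

Lemma HB_subspace g (M : nat -> 'rV[R]_g -> Prop) i c :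
  subspace phi (M c) -> subspace phi (HB M i c).
Proof.
move=> /(@subspace_kin _ _ _ _ _ n i.+1)[M0 MD]; split=> [|a u v].
  by exists 0; rewrite ?linear0.
case=> [eu Mu ->] [ev Mv ->]; exists (phi a *: eu + ev); first exact: MD.
by rewrite linearP.
Qed.

Lemma HZ_subspace g dg (M : nat -> 'rV[R]_g -> Prop) i c :
  subspace phi (M c.+1) -> subspace phi (HZ dg M i c).
Proof.
move=> /(@subspace_kin _ _ _ _ _ n i)[M0 MD].
have [H0 HD] := HB_subspace i (gsub dg c).
split=> [|a u v [Mu Hu] [Mv Hv]]; first by split.
by split; [apply: MD | apply: HD].
Qed.

(** * Short exact sequences 0 -> Z -> F -> M -> 0 with F graded free *)

Section OneStep.
Variables (g1 g0 : nat) (d1 : 'I_g1 -> nat) (d0 : 'I_g0 -> nat).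
Variable D : 'M[R]_(g1, g0).
Hypothesis hD : homog_mx d1 d0 D.
Variables (M : nat -> 'rV[R]_g0 -> Prop) (Z : nat -> 'rV[R]_g1 -> Prop).
Hypothesis ME : forall c w, M c w <-> exists2 u, gpiece d1 c u & w = u *m D.
Hypothesis ZE : forall c u, Z c u <-> gpiece d1 c u /\ u *m D = 0.

Lemma image_subspace c : subspace phi (M c).
Proof.
have [G0 GD] := gsub d1 c; split=> [|a u v].
  by apply/ME; exists 0; rewrite ?mul0mx.
move=> /ME[u' cu ->] /ME[v' cv ->]; apply/ME; exists (phi a *: u' + v').
  exact: GD.
by rewrite mulmxDl scalemxAl.
Qed.

Lemma kernel_subspace c : subspace phi (Z c).
Proof.
have [G0 GD] := gsub d1 c; split=> [|a u v].
  by apply/ZE; rewrite mul0mx.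
move=> /ZE[cu u0] /ZE[cv v0]; apply/ZE; split; first exact: GD.
by rewrite mulmxDl -scalemxAl u0 v0 scaler0 addr0.
Qed.

Lemma image_gpiece c w : M c w -> gpiece d0 c w.
Proof. by move/ME=> [u cu ->]; apply: gpiece_mul cu. Qed.

Local Notation kD := (kmap (mulmxr D)).

Lemma kmap_image c i (u : kos 'rV[R]_g1 n) :
  kin (gpiece d1 c) i u -> kin (M c) i (kD u).
Proof. by apply: kmap_kin => v cv; apply/ME; exists v. Qed.

Lemma kmap_image_lift c i (w : kos 'rV[R]_g0 n) :
  kin (M c) i w -> exists2 u, kin (gpiece d1 c) i u & kD u = w.
Proof. by apply: kmap_lift => v /ME[u cu ->]; exists u. Qed.

Lemma kmap_kernel c i (u : kos 'rV[R]_g1 n) :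
  kin (gpiece d1 c) i u -> kD u = 0 -> kin (Z c) i u.
Proof. by apply: kmap_ker => v cv v0; apply/ZE. Qed.

Lemma kernel_kmap c i (u : kos 'rV[R]_g1 n) :
  kin (Z c) i u -> kin (gpiece d1 c) i u /\ kD u = 0.
Proof.
move=> Zu; split; first by apply: kin_sub Zu => v /ZE[].
have : kin (fun v : 'rV[R]_g0 => v = 0) i (kD u).
  by apply: kmap_kin Zu => v /ZE[].
exact: kin_zero.
Qed.

Lemma gpiece_kd g (dg : 'I_g -> nat) c i (u : kos 'rV[R]_g n) :
  kin (gpiece dg c) i.+1 u -> kin (gpiece dg c.+1) i (kd l u).
Proof.
have sG := gsub dg c.+1.
apply: kd_kin => [k v _|||]; first exact: gpieceZ.
- by case: sG.
- by move=> v; apply: subspaceN sG.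
- by move=> v w; apply: subspaceD sG.
Qed.

Lemma gpieceB g (dg : 'I_g -> nat) c i (u v : kos 'rV[R]_g n) :
  kin (gpiece dg c) i u -> kin (gpiece dg c) i v -> kin (gpiece dg c) i (u - v).
Proof. exact: (subspaceB (subspace_kin n i (gsub dg c))). Qed.

(** The connecting isomorphism: a cycle of [Z] bounds some e in the free module, and its partner is
    the image of e under [D]. Exactness of the Koszul complex of the free modules makes this
    bijective on classes. *)
Lemma qdim_shift i c r :
  qdim phi (HZ d1 Z i c.+1) (HB Z i c.+1) r ->
  qdim phi (HZ d0 M i.+1 c) (HB M i.+1 c) r.
Proof.
pose Q w v := exists2 e : kos 'rV[R]_g1 n, kin (gpiece d1 c.+1) i.+1 e &
  w = kd l e /\ v = kD e.
apply: (@qdim_rel _ _ _ phi phi _ _ _ _ _ _ Q).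
- exact: HZ_subspace (kernel_subspace _).
- exact: HZ_subspace (image_subspace _).
- exists 0; last by rewrite !linear0.
  by apply: kin0; case: (gsub d1 c.+1).
- move=> a u u' v v' [e1 c1 [-> ->]] [e2 c2 [-> ->]].
  exists (phi a *: e1 + e2); last by rewrite !linearP.
  by case: (subspace_kin n i.+1 (gsub d1 c.+1)) => _; apply.
- move=> w [Zw [e ce def_w]]; exists (kD e); last by exists e.
  split; first exact: kmap_image.
  apply: row_acyclic => //.
    by apply: kin_sub (kmap_image ce) => v; apply: image_gpiece.
  by rewrite -kmap_kd -def_w; case: (kernel_kmap Zw).
- move=> v [Mv [z cz def_v]]; have [e ce def_e] := kmap_image_lift Mv.
  exists (kd l e); last by exists e.
  split; last by exists e.
  apply: kmap_kernel; first exact: gpiece_kd.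
  by rewrite kmap_kd def_e def_v kdK.
- move=> _ _ _ _ [e ce [-> ->]]; split=> [[e' Ze' de']|[z Mz dz]].
    have [ce' De'] := kernel_kmap Ze'.
    have [||t ct dt] := row_acyclic l1 lreg (dg := d1) (c := c) (i := i) (u := e - e').
    + exact: gpieceB.
    + by rewrite linearB /= de' subrr.
    exists (kD t); first exact: kmap_image.
    by rewrite -kmap_kd -dt linearB /= De' subr0.
  have [t ct def_t] := kmap_image_lift Mz.
  exists (e - kd l t); last by rewrite linearB /= kdK subr0.
  apply: kmap_kernel; first by apply: gpieceB => //; apply: gpiece_kd.
  by rewrite linearB /= kmap_kd def_t dz subrr.
Qed.

Lemma kos_fin_kernel : kos_fin M -> kos_fin Z.
Proof.
(* F / mF, the homology of the free module in exterior degree 0, lives in degrees up to B; above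
   them every cycle of [Z] bounds in F. *)
case=> C MC; pose B := \max_q d1 q; exists (C + B).+1 => c i w le_Cc Zw dw.
case: c le_Cc Zw => // c le_Cc Zw; have [cw Dw] := kernel_kmap Zw.
have [e ce def_w] : exists2 e, kin (gpiece d1 c.+1) i.+1 e & w = kd l e.
  case: i Zw cw => [|i] Zw cw; last exact: row_acyclic.
  have [v cv def_w] := (kembP _ _).1 cw.
  have [|b cb def_v] := row_gen l1 lgen cv.
    move=> q; apply/eqP/negPn/negP => /cv; rewrite mdeg0 add0n => -[dq].
    have : (d1 q <= B)%N by apply: (leq_bigmax q).
    by rewrite dq; lia.
  have [u cu du] := kin1_kd l (P := gpiece d1 c.+1) (r := n) (fun k _ => cb k).
  by exists u => //; rewrite du -def_v.
(* The image of e is a cycle of [M] in high degree, so it bounds; lifting what it bounds corrects e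
   to an element over [Z]. *)
have [|||z Mz dz] := MC c i.+1 (kD e).
- lia.
- exact: kmap_image.
- by rewrite -kmap_kd -def_w.
have [t ct def_t] := kmap_image_lift Mz.
exists (e - kd l t); last by rewrite linearB /= kdK subr0.
apply: kmap_kernel; first by apply: gpieceB => //; apply: gpiece_kd.
by rewrite linearB /= kmap_kd def_t dz subrr.
Qed.

End OneStep.

(** * From the fibre of a graded free resolution to the Koszul homology of I *)

Section Resolution.
Variables (I : idealr R) (F : free_complex K n).
Hypothesis I_homog : homogeneous_ideal I.
Hypothesis I_const0 : forall f, f \in I -> f@_0%MM = 0.
Hypothesis resF : graded_free_resolution I F.

(* The resolution augmented by R in homological degree 0. *)
Definition arank k := if k is k'.+1 then grank F k' else 1%N.

Definition adeg k : 'I_(arank k) -> nat :=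
  match k with 0 => fun=> 0%N | k'.+1 => @gdeg _ _ F k' end.

Definition adiff k : 'M[R]_(arank k.+1, arank k) :=
  match k with 0 => gaug F | k'.+1 => gdiff F k' end.

Definition aimage k c (w : 'rV[R]_(arank k)) : Prop :=
  exists2 u, gpiece (@adeg k.+1) c u & w = u *m adiff k.

Lemma adiff_homog k : homog_mx (@adeg k.+1) (@adeg k) (adiff k).
Proof.
case: k => [|k] p q m; rewrite -mcoeff_msupp; last exact: (gdiff_homog resF).
rewrite /= ord1 addn0 => /(dhomog_mf (gaug_homog resF p)).
by [].
Qed.

Arguments adiff_homog : clear implicits.

Lemma adiff_exact k (u : 'rV[R]_(arank k.+1)) :
  u *m adiff k = 0 <-> exists v, u = v *m adiff k.+1.
Proof. by case: k u => [|k] u;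
  [apply: (gexact0 resF) | apply: (gexactS resF)]. Qed.

Lemma gcomp_adiff k c u :
  gcomp (@adeg k) c (u *m adiff k) = gcomp (@adeg k.+1) c u *m adiff k.
Proof.
apply: (@gcomp_morph _ _ _ _ _ _ (mulmxr (adiff k)) id) => // e v.
exact: gpiece_mul (adiff_homog k).
Qed.

Lemma aimageS k c u :
  aimage (k := k.+1) c u <-> gpiece (@adeg k.+1) c u /\ u *m adiff k = 0.
Proof.
split=> [[v cv ->]|[cu /adiff_exact[v def_u]]].
  split; first exact: gpiece_mul (adiff_homog _) cv.
  by apply/adiff_exact; exists v.
exists (gcomp (@adeg k.+2) c v); first exact: gcomp_gpiece.
by rewrite -gcomp_adiff -def_u gcomp_id.
Qed.

Lemma aimage0 c w :
  aimage (k := 0) c w <-> gpiece (fun=> 0%N) c w /\ w 0 0 \in I.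
Proof.
split=> [[v cv ->]|[cw /(gaug_image resF)[u def_w]]].
  split; first exact: (gpiece_mul (adiff_homog 0) cv).
  by apply/(gaug_image resF); exists v.
exists (gcomp (@adeg 1) c u); first exact: gcomp_gpiece.
rewrite -gcomp_adiff; have -> : u *m adiff 0 = w.
  by apply/rowP => q; rewrite ord1.
by rewrite gcomp_id.
Qed.

(** Dimension shifting, with one connecting isomorphism for each syzygy module on the way down to
    I. *)
Lemma qdim_aimage i k j r :
  qdim phi (HZ (@adeg i) (aimage (k := i)) k (i + j)) (HB (aimage (k := i)) k (i + j)) r ->
  qdim phi (HZ (@adeg 0) (aimage (k := 0)) (i + k) j) (HB (aimage (k := 0)) (i + k) j) r.
Proof.
elim: i k => [|i IH] k // di; rewrite addSnnS; apply: IH; move: di.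
by apply: (qdim_shift (adiff_homog i)) => // c u; apply: aimageS.
Qed.

Local Notation cst := (map_mx (@mcoeff n K 0%MM)).

Lemma degree_mxP i j (v : 'rV[K]_(grank F i)) :
  (v <= degree_mx F i j)%MS <-> forall p, v 0 p != 0 -> gdeg p = j.
Proof.
split=> [/submxP[y ->] p|vj].
  by rewrite mul_mx_diag !mxE; case: (gdeg p =P j) => // _; rewrite mulr0 eqxx.
suff <- : v *m degree_mx F i j = v by apply: submxMl.
apply/rowP => p; rewrite mul_mx_diag !mxE.
by have [->|/vj ->] := eqVneq (v 0 p) 0; rewrite ?mul0r // eqxx mulr1.
Qed.

Lemma cst_gpiece i j u : gpiece (@adeg i.+1) j.+1 u -> (cst u <= degree_mx F i j)%MS.
Proof.
move=> cu; apply/degree_mxP => p; rewrite mxE => /cu.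
by rewrite mdeg0 add0n => -[].
Qed.

Lemma lift_gpiece i j (v : 'rV[K]_(grank F i)) :
  (v <= degree_mx F i j)%MS ->
  gpiece (@adeg i.+1) j.+1 (map_mx phi v) /\ cst (map_mx phi v) = v.
Proof.
move/degree_mxP => vj; split=> [p m|]; last first.
  by apply/rowP => p; rewrite !mxE mcoeffC eqxx mulr1.
rewrite mxE mcoeffC; case: (m =P 0%MM) => [->|_]; last by rewrite mulr0 eqxx.
by rewrite mulr1 mdeg0 add0n => /vj <-.
Qed.

(** For i = 0 both conditions are empty, because the entries of the augmentation lie in I and have
    no constant term. *)
Lemma cst_adiff i (v : 'rV[K]_(grank F i)) :
  v *m fiber_out F i = 0 <-> v *m cst (adiff i) = 0.
Proof.
case: i v => [|i] v //; split=> _; rewrite ?mulmx0 //.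
suff -> : cst (adiff 0) = 0 by rewrite mulmx0.
apply/matrixP => p q; rewrite !mxE ord1; apply: I_const0.
by apply/(gaug_image resF); exists (delta_mx 0 p); rewrite -rowE mxE.
Qed.

Lemma fiber_boundaryP i j (v : 'rV[K]_(grank F i)) :
  (v <= degree_mx F i.+1 j *m fiber_diff F i)%MS <->
  exists2 y, (y <= degree_mx F i.+1 j)%MS & v = y *m fiber_diff F i.
Proof.
split=> [/submxP[z ->]|[y yj ->]]; last exact: submxMr.
by exists (z *m degree_mx F i.+1 j); rewrite ?submxMl ?mulmxA.
Qed.

Lemma cst_lin_sum g (b : nat -> 'rV[R]_g) : cst (\sum_(j < n) l j *: b j) = 0.
Proof.
apply/rowP => q; rewrite !mxE summxE raddf_sum big1 // => j _ /=.
rewrite mxE mcoeff0M (dhomog_nemf_coeff (l1 j)) ?mul0r //.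
by rewrite /= mdeg0.
Qed.

Lemma fiber_boundary_cycle i j (v : 'rV[K]_(grank F i)) :
  (v <= degree_mx F i.+1 j *m fiber_diff F i)%MS ->
  (v <= degree_mx F i j :&: kermx (fiber_out F i))%MS.
Proof.
move=> /fiber_boundaryP[y /lift_gpiece[cy <-] ->].
have -> : cst (map_mx phi y) *m fiber_diff F i = cst (map_mx phi y *m adiff i.+1).
  by rewrite map_mxM.
have Dy : map_mx phi y *m adiff i.+1 *m adiff i = 0.
  by apply/adiff_exact; exists (map_mx phi y).
rewrite sub_capmx (cst_gpiece (gpiece_mul (adiff_homog i.+1) cy)) /=.
by apply/sub_kermxP/cst_adiff; rewrite -map_mxM Dy map_mx0.
Qed.

(** Let M be the image of F_i in the preceding term E. Both sides compute (M meet mE) / mM: a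
    constant row is a fibre cycle if the image of its lift has no constant term, and a boundary if
    that image lies in mM. *)
Lemma qdim_fiber i j r :
  qdim (idfun : {rmorphism K -> K})
    (fun v : 'rV[K]_(grank F i) => (v <= degree_mx F i j :&: kermx (fiber_out F i))%MS)
    (fun v => (v <= degree_mx F i.+1 j *m fiber_diff F i)%MS) r ->
  qdim phi (HZ (@adeg i) (aimage (k := i)) 0 j) (HB (aimage (k := i)) 0 j) r.
Proof.
have MEi k c (w : 'rV[R]_(arank k)) :
  aimage c w <-> exists2 u, gpiece (@adeg k.+1) c u & w = u *m adiff k by [].
pose Q (v : 'rV[K]_(grank F i)) (w : kos 'rV[R]_(arank i) n) :=
  exists2 u, gpiece (@adeg i.+1) j.+1 u & v = cst u /\ w = kemb n (u *m adiff i).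
apply: (@qdim_rel _ _ _ (idfun : {rmorphism K -> K}) phi _ _ _ _ _ _ Q).
- split=> [|c u v]; first exact: sub0mx.
  by move=> su sv; apply: addmx_sub => //; apply: scalemx_sub.
- apply: HZ_subspace; exact: image_subspace (MEi i) _.
- exists 0; first by case: (gsub (@adeg i.+1) j.+1).
  by rewrite mul0mx linear0 map_mx0.
- move=> a v w v' w' [u cu [-> ->]] [u' cu' [-> ->]]; exists (phi a *: u + u').
    by case: (gsub (@adeg i.+1) j.+1) => _; apply.
  split; first by apply/rowP => q; rewrite !mxE mcoeffD mcoeffCM.
  by rewrite mulmxDl -scalemxAl linearP.
- move=> v; rewrite sub_capmx => /andP[/lift_gpiece[cv def_v] /sub_kermxP/cst_adiff kv].
  exists (kemb n (map_mx phi v *m adiff i)); last by exists (map_mx phi v).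
  split; first by apply/kembP; eexists; last reflexivity; exists (map_mx phi v).
  have [|b cb ->] := row_gen l1 lgen (gpiece_mul (adiff_homog i) cv).
    move=> q; have /rowP/(_ q) : cst (map_mx phi v *m adiff i) = 0.
      by rewrite map_mxM def_v.
    by rewrite !mxE.
  by have [u cu <-] := kin1_kd l (P := gpiece (@adeg i) j) (r := n) (fun k _ => cb k); exists u.
- move=> w [/kembP[_ [u cu ->] ->] [e ce de]].
  exists (cst u); last by exists u.
  rewrite sub_capmx (cst_gpiece cu); apply/sub_kermxP/cst_adiff.
  have [b _ def_b] := kd_kin1 l ce; move: de; rewrite def_b => /kemb_inj de.
  by rewrite -map_mxM de cst_lin_sum.
- move=> _ _ _ _ [u cu [-> ->]].
  have sG := gsub (@adeg i.+1).
  split=> [/fiber_boundaryP[y /lift_gpiece[cy def_y] def_v]|[e Me de]].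
    (* Same image as u under the differential, but no constant term; so this image lies in mM. *)
    pose t := u - map_mx phi y *m adiff i.+1.
    have ct : gpiece (@adeg i.+1) j.+1 t.
      exact: subspaceB (sG _) cu (gpiece_mul (adiff_homog i.+1) cy).
    have [|b cb def_t] := row_gen l1 lgen ct.
      move=> q; have /rowP/(_ q) : cst t = 0; last by rewrite !mxE.
      by rewrite map_mxB map_mxM def_y def_v subrr.
    have Dt : u *m adiff i = \sum_(k < n) l k *: (b k *m adiff i).
      have -> : u *m adiff i = t *m adiff i.
        rewrite mulmxBl; set z := _ *m adiff i.+1 *m _.
        have -> : z = 0 by apply/adiff_exact; exists (map_mx phi y).
        by rewrite subr0.
      by rewrite def_t mulmx_suml; apply: eq_bigr => k _; rewrite scalemxAl.
    have [k _|e Me de] := kin1_kd l (P := aimage (k := i) j) (r := n) (a := fun k => b k *m adiff i).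
      by exists (b k).
    by exists e => //; rewrite de Dt.
  have [a Ma da] := kd_kin1 l Me; move: de; rewrite da => /kemb_inj def_u.
  have /fin_all_exists2[b cb def_b] := fun k : 'I_n => Ma k (ltn_ord k).
  (* A syzygy with the same constant term as u; exactness lifts it, and the constant part of the
     lift shows that u gives a boundary. *)
  pose t := u - \sum_(k < n) l k *: b k.
  have ct : gpiece (@adeg i.+1) j.+1 t.
    apply: subspaceB (sG _) cu _; apply: subspace_sum (sG _) _ => k.
    exact: gpieceZ.
  have [u' cu' def_t] : aimage (k := i.+1) j.+1 t.
    apply/aimageS; split=> //; rewrite mulmxBl def_u mulmx_suml.
    by apply/eqP; rewrite subr_eq0; apply/eqP/eq_bigr => k _;
      rewrite -scalemxAl def_b.
  apply/fiber_boundaryP; exists (cst u'); first exact: cst_gpiece.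
  have := congr1 cst def_t; rewrite map_mxM /= => <-; rewrite map_mxB.
  have -> : cst (\sum_(k < n) l k *: b k) = 0; last by rewrite subr0.
  have := @cst_lin_sum _ (fun k => if insub k is Some k' then b k' else 0).
  by under eq_bigr => k _ do rewrite valK.
Qed.

Lemma qdim_fiber_homology i j :
  qdim phi (HZ (@adeg 0) (aimage (k := 0)) i j) (HB (aimage (k := 0)) i j)
    (fiber_homology_dim F i (i + j)).
Proof.
rewrite -{1 2}[i]addn0; apply: qdim_aimage; apply: qdim_fiber.
apply: qdim_mxrank; apply/row_subP => p; apply: fiber_boundary_cycle.
exact: row_sub.
Qed.

End Resolution.
End Homology.

(** * Existence of graded free resolutions *)

Section Existence.
Variables (K : fieldType) (n : nat).
Local Notation R := {mpoly K[n]}.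
Local Notation phi := (@mpolyC n K : {rmorphism K -> R}).

Variable l : nat -> R.
Hypothesis l1 : forall k, l k \is 1.-homog.
Hypothesis lreg : forall k (v : R) (a : nat -> R), (k < n)%N ->
  l k * v = \sum_(j < k) l j * a j ->
  exists b : nat -> R, v = \sum_(j < k) l j * b j.
Hypothesis lgen : forall f : R, f@_0%MM = 0 ->
  exists b : nat -> R, f = \sum_(j < n) l j * b j.

Definition submodule g (M : 'rV[R]_g -> Prop) : Prop :=
  M 0 /\ forall a u v, M u -> M v -> M (a *: u + v).

Lemma submodule_sum g (M : 'rV[R]_g -> Prop) r (a : 'I_r -> R) b :
  submodule M -> (forall i, M (b i)) -> M (\sum_i a i *: b i).
Proof.
case=> M0 MD Mb; elim/big_rec: _ => // i u _ Mu; exact: MD.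
Qed.

(* Finiteness of Koszul homology replaces the Hilbert basis theorem: it bounds
   the degrees of generators and is inherited by syzygies. *)
Definition tame g (dg : 'I_g -> nat) (M : 'rV[R]_g -> Prop) : Prop :=
  [/\ submodule M, forall c u, M u -> M (gcomp dg c u)
    & kos_fin l (fun c u => gpiece dg c u /\ M u)].

(** The generated submodule, as an intersection; the number paired with a row will record its
    degree. *)
Definition span_of g (s : seq (nat * 'rV[R]_g)) (u : 'rV[R]_g) : Prop :=
  forall N : 'rV[R]_g -> Prop, submodule N -> {in s, forall p, N p.2} -> N u.

Lemma submodule_span_of g (s : seq (nat * 'rV[R]_g)) : submodule (span_of s).
Proof.
split=> [N [] //|a u v Su Sv N sN Ns]; case: (sN) => _; apply;
  [exact: Su | exact: Sv].
Qed.

Lemma tame_low_span g (dg : 'I_g -> nat) M C : tame dg M ->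
  exists2 s : seq (nat * 'rV[R]_g),
    {in s, forall p, gpiece dg p.1.+1 p.2 /\ M p.2}
    & forall c u, (c <= C)%N -> gpiece dg c u -> M u -> span_of s u.
Proof.
case=> sM _ _; elim: C => [|C [s sM' sS]].
  by exists [::] => // c u; rewrite leqn0 => /eqP -> /gpiece0 -> _ N [].
have [G0 GD] := @gpiece_subspace K n _ dg C.+1; case: (sM) => M0 MD.
have [|||r [v [Mv vS _]]] := @gpiece_qdim K n _ dg C.+1 (fun u => gpiece dg C.+1 u /\ M u)
  (fun u => u = 0).
- by split=> // a u w [cu Mu] [cw Mw]; split; [apply: GD | apply: MD].
- by split=> // a u w -> ->; rewrite scaler0 addr0.
- by move=> z [].
exists (s ++ [seq (C, v i) | i <- enum 'I_r]) => [p|c u].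
  rewrite mem_cat => /orP[/sM'//|/mapP[i _ ->]]; exact: Mv.
rewrite leq_eqVlt => /orP[/eqP -> cu Mu N sN Ns|].
  have [a /eqP] := vS u (conj cu Mu); rewrite subr_eq0 => /eqP ->.
  apply: submodule_sum => // i; apply: (Ns (C, v i)).
  by rewrite mem_cat map_f ?orbT // mem_enum.
rewrite ltnS => le_cC cu Mu N sN Ns; apply: (sS c u) => // p sp.
by apply: Ns; rewrite mem_cat sp.
Qed.

Lemma tame_span g (dg : 'I_g -> nat) M : tame dg M ->
  exists2 s : seq (nat * 'rV[R]_g),
    {in s, forall p, gpiece dg p.1.+1 p.2 /\ M p.2} & forall u, M u -> span_of s u.
Proof.
move=> tM; case: (tM) => sM gM [C MC]; have [s Ms sS] := tame_low_span C tM.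
exists s => // u Mu; have [N ->] := gcomp_sum dg u.
suff spanc c w : gpiece dg c w -> M w -> span_of s w.
  elim/big_ind: _ => [|v w Sv Sw|c _]; first by case: (submodule_span_of s).
    by rewrite -[v]scale1r; case: (submodule_span_of s) => _; apply.
  by apply: spanc; [apply: gcomp_gpiece | apply: gM].
have [le_cC|lt_Cc] := leqP c C; first exact: sS.
elim: c lt_Cc w => // c IH; rewrite ltnS => le_Cc w cw Mw.
have Mkw : kin (fun v => gpiece dg c.+1 v /\ M v) 0 (kemb n w) by apply/kembP;
  exists w.
(* Above C the quotient M / mM vanishes, so w is a combination of elements of M one degree lower. *)
have [e Me de] := MC c 0 (kemb n w) le_Cc Mkw (kd_kin0 _ Mkw).
have [a Ma da] := kd_kin1 l Me; move: de; rewrite da => /kemb_inj ->.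
apply: submodule_sum => [|k]; first exact: submodule_span_of.
have [ca Mak] := Ma k (ltn_ord k); have [le_cC|lt_Cc] := leqP c C;
  first exact: (sS c).
exact: IH.
Qed.

Lemma tame_cover g (dg : 'I_g -> nat) M : tame dg M ->
  exists g1 (d1 : 'I_g1 -> nat) (D : 'M[R]_(g1, g)),
    homog_mx d1 dg D /\ forall w, M w <-> exists u, w = u *m D.
Proof.
move=> tM; have [s Ms sS] := tame_span tM; pose t := in_tuple s.
exists (size s), (fun p => (tnth t p).1), (\matrix_p (tnth t p).2).
split=> [p q m|w]; first by rewrite mxE => /(Ms _ (mem_tnth p t)).1[].
split=> [/sS|[u ->]]; last first.
  case: tM => sM _ _; rewrite mulmx_sum_row; apply: submodule_sum => // p.
  by rewrite rowK; case: (Ms _ (mem_tnth p t)).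
move=> Sw; pose D := \matrix_p (tnth t p).2.
apply: (Sw (fun w => exists u, w = u *m D)) => [|p];
  first split=> [|a u v [u' ->] [v' ->]].
- by exists 0; rewrite mul0mx.
- by exists (a *: u' + v'); rewrite mulmxDl scalemxAl.
case/(tnthP t) => i ->; exists (delta_mx 0 i).
by rewrite -rowE rowK.
Qed.

Lemma tame_kernel g g1 (dg : 'I_g -> nat) (d1 : 'I_g1 -> nat) M D :
  tame dg M -> homog_mx d1 dg D -> (forall w, M w <-> exists u, w = u *m D) ->
  tame d1 (fun u => u *m D = 0).
Proof.
case=> sM gM fM hD MD.
have gD c u : gcomp dg c (u *m D) = gcomp d1 c u *m D.
  by apply: (@gcomp_morph _ _ _ _ _ _ (mulmxr D) id) => // e v;
    apply: gpiece_mul.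
split.
- split=> [|a u v u0 v0]; first by rewrite mul0mx.
  by rewrite mulmxDl -scalemxAl u0 v0 scaler0 addr0.
- by move=> c u u0; rewrite -gD u0 raddf0.
apply: (kos_fin_kernel (d1 := d1) (D := D) l1 lreg lgen _ _ fM) => // c w;
  split.
  case=> cw /MD[u def_w]; exists (gcomp d1 c u); first exact: gcomp_gpiece.
  by rewrite -gD -def_w gcomp_id.
by case=> u cu ->; split; [apply: gpiece_mul cu | apply/MD; exists u].
Qed.

(** Ranks change along the resolution, so each module travels with its ambient free module and the
    kernel step becomes a function from stages to stages. *)
Record stage := Stage {
  sg : nat;
  sd : 'I_sg -> nat;
  sM : 'rV[R]_sg -> Prop;
  s_tame : tame sd sM
}.

Record cover (s : stage) := Cover {
  cg : nat;
  cd : 'I_cg -> nat;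
  cD : 'M[R]_(cg, sg s);
  cD_homog : homog_mx cd (@sd s) cD;
  cD_image : forall w, sM w <-> exists u, w = u *m cD
}.

Lemma cover_exists s : exists c : cover s, True.
Proof.
by have [g1 [d1 [D [hD MD]]]] := tame_cover (s_tame s); exists (Cover hD MD).
Qed.

Definition pick_cover s : cover s :=
  proj1_sig (constructive_indefinite_description _ (cover_exists s)).

Definition next_stage s : stage :=
  Stage (tame_kernel (s_tame s) (@cD_homog _ (pick_cover s)) (@cD_image _ (pick_cover s))).

Fixpoint nth_stage (s : stage) k : stage :=
  if k is k'.+1 then next_stage (nth_stage s k') else s.

Variable I : idealr R.
Hypothesis I_homog : homogeneous_ideal I.
Hypothesis I_high : exists C, forall c (u : 'rV[R]_1),
  (C <= c)%N -> gpiece (fun=> 0%N) c u -> u 0 0 \in I.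

Lemma ideal_tame : tame (fun _ : 'I_1 => 0%N) (fun u => u 0 0 \in I).
Proof.
split.
- split=> [|a u v Iu Iv]; first by rewrite mxE rpred0.
  by rewrite !mxE rpredD // idealMr.
- move=> c u Iu; rewrite mxE; case: ifP => _; last exact: rpred0.
  exact: I_homog.
have [C IC] := I_high; exists C.+1 => c i w lt_Cc Iw dw.
have cw : kin (gpiece (fun=> 0%N) c.+1) i w by apply: kin_sub Iw => v [].
(* In high degrees I agrees with R, so the vanishing is that for R. *)
suff [e ce ->] : HB l (gpiece (fun _ : 'I_1 => 0%N)) i c w.
  exists e => //; apply: kin_sub ce => v cv; split=> //; apply: IC cv.
  exact: ltnW.
case: i Iw cw => [|i] _ cw; last exact: row_acyclic.
have [v cv def_w] := (kembP _ _).1 cw.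
have [|b cb def_v] := row_gen l1 lgen cv.
  move=> q; apply/eqP/negPn/negP => /cv; rewrite mdeg0 => -[c0].
  by rewrite -c0 in lt_Cc.
have [u cu du] := kin1_kd l (P := gpiece (fun _ : 'I_1 => 0%N) c) (r := n) (fun k _ => cb k).
by exists u => //; rewrite du -def_v.
Qed.

Definition ideal_complex : free_complex K n :=
  let s := nth_stage (Stage ideal_tame) in
  @FreeComplex K n (fun i => cg (pick_cover (s i)))
    (fun i => @cd _ (pick_cover (s i))) (fun i => cD (pick_cover (s i.+1)))
    (cD (pick_cover (s 0))).

Lemma resolution_exists : exists F, graded_free_resolution I F.
Proof.
pose s := nth_stage (Stage ideal_tame); exists ideal_complex; split.
- move=> i p q m; rewrite mcoeff_msupp.
  exact: (@cD_homog _ (pick_cover (s i.+1))).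
- move=> p; apply/dhomogP => m; rewrite mcoeff_msupp.
  by move/(@cD_homog _ (pick_cover (s 0))); rewrite addn0.
- move=> f; split=> [If|[u ->]].
    have [u def_u] : exists u, f%:M = u *m cD (pick_cover (s 0)).
      by apply/(@cD_image _ (pick_cover (s 0))); rewrite /= mxE eqxx.
    by exists u; rewrite /= -def_u mxE eqxx.
  by apply/(@cD_image _ (pick_cover (s 0))); exists u.
- move=> u; exact: (@cD_image _ (pick_cover (s 1%N))).
- move=> i u; exact: (@cD_image _ (pick_cover (s i.+2))).
Qed.

End Existence.

(** * Betti numbers of an m-full ideal *)

Section MFull.
Variables (K : fieldType) (n : nat).
Local Notation R := {mpoly K[n.+1]}.
Local Notation phi := (@mpolyC n.+1 K : {rmorphism K -> R}).
Variable I : idealr R.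
Hypothesis I_homog : homogeneous_ideal I.
Hypothesis I_primary : irrelevant_primary I.
Variable x : R.
Hypothesis x1 : x \is 1.-homog.
Hypothesis x_full : mfull_at (@irrelevant K n.+1) (fun f => f \in I) x.

Local Notation mI := (ideal_mul (@irrelevant K n.+1) (fun f => f \in I)).
Implicit Types f g : R.
Local Notation row1 := 'rV[R]_1.
Local Notation piece := (@gpiece K n.+1 1 (fun=> 0%N)).

Lemma ideal_const0 f : f \in I -> f@_0%MM = 0.
Proof. by move=> If; apply/irrelevantP/I_primary.2; exists 1%N. Qed.

Lemma is_ideal_I : is_ideal (fun f => f \in I).
Proof. by split=> [|a f g If Ig]; rewrite ?rpred0 ?rpredD ?idealMr. Qed.

Lemma is_ideal_mI : is_ideal mI.
Proof.
split=> [|a f g [s Is ->] [t It ->]]; first by exists [::]; rewrite ?big_nil.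
exists ([seq (a * q.1, q.2) | q <- s] ++ t) => [q|].
  rewrite mem_cat => /orP[/mapP[r /Is[mr Ir] ->]|/It//]; split=> //=.
  by apply/irrelevantP; rewrite mcoeff0M; move/irrelevantP: mr => ->;
    rewrite mulr0.
rewrite big_cat big_map mulr_sumr; congr (_ + _).
by apply: eq_bigr => q _; rewrite mulrA.
Qed.

Lemma mI_mul f g : f@_0%MM = 0 -> g \in I -> mI (f * g).
Proof.
move=> f0 Ig; exists [:: (f, g)]; last by rewrite big_seq1.
by move=> q; rewrite inE => /eqP ->; split=> //; apply/irrelevantP.
Qed.

Lemma homog1_const0 (f : R) : f \is 1.-homog -> f@_0%MM = 0.
Proof. by move=> f1; apply: (dhomog_nemf_coeff f1); rewrite /= mdeg0. Qed.

Lemma colon_mI f : mI (x * f) -> f \in I.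
Proof. by move/x_full. Qed.

(* I : x = I : m *)
Lemma socle f g : x * f \in I -> g@_0%MM = 0 -> g * f \in I.
Proof.
by move=> Ixf g0; apply: colon_mI; rewrite mulrCA; apply: mI_mul.
Qed.

Lemma var_pow i : exists k, 'X_i ^+ k.+1 \in I.
Proof.
have [[|k] Ik] : radical I 'X_i; last by exists k.
  by apply/I_primary.2/irrelevantP/mpolyX_const0.
by rewrite expr0 idealr1 in Ik.
Qed.

(** Otherwise mI : x would be R, whereas I is proper. *)
Lemma x_neq0 : x != 0.
Proof.
apply/eqP => x0; suff /ideal_const0/eqP : 1 \in I by rewrite mcoeff1 eqxx oner_eq0.
by apply: colon_mI; rewrite x0 mul0r; case: is_ideal_mI.
Qed.

Lemma pieceP c (u : row1) : piece c.+1 u <-> u 0 0 \is c.-homog.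
Proof.
split=> [cu|/dhomogP cu q m]; last first.
  by rewrite !ord1 -mcoeff_msupp => /cu /= ->; rewrite addn0.
by apply/dhomogP => m; rewrite mcoeff_msupp => /cu; rewrite addn0 => -[].
Qed.

Lemma ideal_high : exists C, forall c (u : row1),
  (C <= c)%N -> piece c u -> u 0 0 \in I.
Proof.
have /fin_all_exists[k Ik] := var_pow.
exists (\sum_i (k i).+1).+1 => -[|c] u // le_c /pieceP/dhomogP cu.
rewrite [u 0 0]mpolyE; apply: (is_ideal_sum is_ideal_I) => m /cu /= dm _.
apply: is_idealZ is_ideal_I _.
(* Pigeonhole on the exponents. *)
have [i le_ki] : exists i, (k i < m i)%N.
  apply/existsP; apply: contraTT le_c => /existsPn lt_m.
  rewrite -ltnNge ltnS -dm mdegE; apply: leq_ltn_trans (_ : \sum_i k i < _)%N.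
    by apply: leq_sum => i _; rewrite leqNgt.
  rewrite (bigD1 ord0) //= [X in (_ < X)%N](bigD1 ord0) //= addSn ltnS leq_add2l.
  by apply: leq_sum => i _.
have -> : m = ((m - U_(i) *+ (k i).+1) + U_(i) *+ (k i).+1)%MM.
  apply/mnmP => j; rewrite mnmDE mnmBE mulmnE mnm1E.
  by case: eqP => [<-|_]; rewrite ?mul1n ?mul0n ?subnK ?subn0 ?addn0.
by rewrite mpolyXD idealMr // -mpolyXn.
Qed.

Variable p : 'I_n.+1.
Hypothesis xp : x@_U_(p) != 0.
Local Notation l := (vars_then x p).
Let l1 := vars_then_homog p x1.
Let lreg := vars_then_regular x1 xp.
Let lgen := vars_then_gen x1 xp.

Definition Ipiece c (u : row1) : Prop := piece c u /\ u 0 0 \in I.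

(** By [socle], x f in I already gives m f in I; modulo I this is the socle of A in degree c - 1. *)
Definition Spiece c (u : row1) : Prop := piece c u /\ x * u 0 0 \in I.

Lemma Ipiece_subspace c : subspace phi (Ipiece c).
Proof.
have [G0 GD] := @gpiece_subspace K n.+1 1 (fun=> 0%N) c.
split=> [|a u v [cu Iu] [cv Iv]]; first by split=> //; rewrite mxE rpred0.
by split; [apply: GD | rewrite !mxE rpredD ?idealMr].
Qed.

Lemma Spiece_subspace c : subspace phi (Spiece c).
Proof.
have [G0 GD] := @gpiece_subspace K n.+1 1 (fun=> 0%N) c.
split=> [|a u v [cu Iu] [cv Iv]]; first by split=> //; rewrite mxE mulr0 rpred0.
split; first exact: GD.
by rewrite !mxE mulrDr mulrCA; apply: rpredD => //; apply: idealMr.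
Qed.

Lemma resolutionP : graded_free_resolution I (resolution I).
Proof.
apply: epsilon_spec; apply: (resolution_exists l1 lreg lgen) => //.
exact: ideal_high.
Qed.

Lemma qdim_betti i j :
  qdim phi (HZ l (fun=> 0%N) Ipiece i j) (HB l Ipiece i j) (betti I i (i + j)).
Proof.
have := qdim_fiber_homology l1 lreg lgen ideal_const0 resolutionP i j.
have E c u := @aimage0 K n.+1 I _ resolutionP c u.
apply: qdim_ext => w; split.
- by case=> cw ew; split=> //; apply: kin_sub cw => v /E.
- by case=> cw ew; split=> //; apply: kin_sub cw => v Iv; apply/E.
- by case=> e ce ->; exists e => //; apply: kin_sub ce => v /E.
- by case=> e ce ->; exists e => //; apply: kin_sub ce => v Iv; apply/E.
Qed.

Lemma socle_dim j : exists s, qdim phi (Spiece j) (Ipiece j) s.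
Proof.
apply: (gpiece_qdim (Spiece_subspace j) (Ipiece_subspace j) (dg := fun=> 0%N) (c := j)).
by move=> z [].
Qed.

Lemma Ipiece_scale c (f : R) u : f \is 1.-homog -> Ipiece c u -> Ipiece c.+1 (f *: u).
Proof.
by move=> f1 [cu Iu]; split; [apply: gpieceZ | rewrite mxE idealMr].
Qed.

Lemma Spiece_scale c (f : R) u : f \is 1.-homog -> Spiece c u -> Ipiece c.+1 (f *: u).
Proof.
move=> f1 [cu Iu]; split; first exact: gpieceZ.
by rewrite mxE; apply: socle => //; apply: homog1_const0.
Qed.

Definition mIrow (u : row1) : Prop := mI (u 0 0).

Lemma mIrow_scale c (f : R) u : f \is 1.-homog -> Ipiece c u -> mIrow (f *: u).
Proof.
by move=> f1 [_ Iu]; rewrite /mIrow mxE; apply: mI_mul => //;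
  apply: homog1_const0.
Qed.

Lemma mIrowD u v : mIrow u -> mIrow v -> mIrow (u + v).
Proof. by rewrite /mIrow mxE; apply: is_idealD is_ideal_mI. Qed.

Lemma mIrowN u : mIrow u -> mIrow (- u).
Proof. by rewrite /mIrow mxE -mulN1r; apply: is_idealM is_ideal_mI. Qed.

Lemma mIrow0 : mIrow 0.
Proof. by rewrite /mIrow mxE; case: is_ideal_mI. Qed.

(* The isomorphism sends s to the class of d(e_n /\ s), where x = l n. *)
Lemma betti_socle i j s :
  i = n \/ (exists2 j0, j = j0.+1 & forall u, piece j u ->
             exists v1 v2, [/\ Ipiece j v1, piece j0 v2 & u = v1 + x *: v2]) ->
  qdim phi (Spiece j) (Ipiece j) s -> betti I i (i + j) = ('C(n, i) * s)%N.
Proof.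
move=> surj ds; have S0 : Spiece j 0 by case: (Spiece_subspace j).
have dk := qdim_kin n i S0 ds.
apply: (qdim_uniq (HB_subspace l i (Ipiece_subspace j)) (qdim_betti i j)).
have ln : l n = x := vars_then_last x p.
have sI c r k := @subspace_kin _ _ _ _ _ r k (Ipiece_subspace c).
have sG c r k := @subspace_kin _ _ _ _ _ r k (@gpiece_subspace K n.+1 1 (fun=> 0%N) c).
have kdI c r k (u : kos row1 r) : kin (Ipiece c) k.+1 u -> kin (Ipiece c.+1) k (kd l u).
  apply: kd_kin => [k' v _||v|v w].
  - exact: Ipiece_scale.
  - by case: (Ipiece_subspace c.+1).
  - exact: subspaceN (Ipiece_subspace c.+1).
  - exact: subspaceD (Ipiece_subspace c.+1).
have kdG c r k (u : kos row1 r) : kin (piece c) k.+1 u -> kin (piece c.+1) k (kd l u).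
  apply: kd_kin => [k' v _||v|v w].
  - exact: gpieceZ.
  - by case: (@gpiece_subspace K n.+1 1 (fun=> 0%N) c.+1).
  - exact: subspaceN (@gpiece_subspace K n.+1 1 (fun=> 0%N) c.+1).
  - exact: subspaceD (@gpiece_subspace K n.+1 1 (fun=> 0%N) c.+1).
pose top (t : kos row1 n) : kos row1 n.+1 := (0, t).
have dtop t : kd l (top t) = (x *: t, - kd l t).
  by rewrite /= linear0 add0r ln.
(* Relates t to all representatives of the class of d(e_x /\ t) modulo boundaries from I. *)
pose Q (t : kos row1 n) (w : kos row1 n.+1) :=
  exists2 e, kin (Ipiece j) i.+1 e & w = kd l (top t) + kd l e.
apply: (@qdim_rel _ _ _ phi phi _ _ _ _ _ _ Q _ _ _ _ _ _ _ _ dk).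
- exact: subspace_kin (Spiece_subspace j).
- exact: HZ_subspace (Ipiece_subspace j.+1).
- exists 0; first by case: (sI j n.+1 i.+1).
  by rewrite dtop scaler0 !linear0 addr0.
- move=> a t w t' w' [e Ie ->] [e' Ie' ->]; exists (phi a *: e + e').
    by case: (sI j n.+1 i.+1) => _; apply.
  have -> : top (phi a *: t + t') = phi a *: top t + top t'.
    by congr (_, _); rewrite /= scaler0 addr0.
  by rewrite !linearP /= scalerDr addrACA.
- move=> t St; exists (kd l (top t)); last first.
    by exists 0; [case: (sI j n.+1 i.+1) | rewrite linear0 addr0].
  split; last first.
    exists (top t) => //=; split; first by case: (sG j n i.+1).
    by apply: kin_sub St => v [].
  rewrite dtop /=; split; first by apply: kinZ St => v; apply: Spiece_scale.
  case: (i) St => [|i'] St; first by rewrite (kd_kin0 l St) oppr0.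
  apply: (subspaceN (sI _ _ _)); move: St; apply: kd_kin => [k' v _||v|v w].
  + exact: Spiece_scale.
  + by case: (Ipiece_subspace j.+1).
  + exact: subspaceN (Ipiece_subspace j.+1).
  + exact: subspaceD (Ipiece_subspace j.+1).
- move=> w [Iw [[a b] [/= ca cb] def_w]].
  (* Surjectivity: with w = d(a + e_x /\ b), only a is in the way. For i = n its exterior degree
     exceeds the number of forms; otherwise it is split as an element over I plus a multiple of
     x. *)
  have [io [ga [Iio cga def_a]]] : exists io ga, [/\ kin (Ipiece j) i.+1 io,
      kin (piece j) i (kd l ga) & a = io + x *: ga].
    case: surj => [i_n|[j0 j_j0 surj]].
      have -> : a = 0 by apply: kin_gt ca; rewrite i_n.
      exists 0, 0; split; last by rewrite scaler0 addr0.
        by case: (sI j n i.+1).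
      by rewrite linear0; case: (sG j n i).
    have [io [ga [Iio cga ->]]] := kin_split surj ca.
    by exists io, ga; split=> //; rewrite j_j0; apply: kdG.
  (* The multiple of x is absorbed into e_x: applying d to d(e_x /\ ga) = x ga - e_x /\ d ga gives
     d(x ga) = d(e_x /\ d ga). *)
  have def_w' : w = kd l (top (b + kd l ga)) + kd l ((io, 0) : kos row1 n.+1).
    rewrite def_w dtop /= ln def_a; congr (_, _) => /=.
      by rewrite !linearD linearZ /= scaler0 addr0 -addrA addrC [x *: kd l ga + _]addrC.
    by rewrite linearD /= kdK addr0 linear0 oppr0 addr0.
  exists (b + kd l ga); last first.
    exists (io, 0) => //=; split=> //; by case: (sI j n i).
  have cs : kin (piece j) i (b + kd l ga) := subspaceD (sG _ _ _) cb cga.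
  apply: (kin_colon (Q := fun v : row1 => v 0 0 \in I) (a := x) _ cs) => [v cv|].
    by rewrite mxE.
  have -> : x *: (b + kd l ga) = w.1 - kd l io.
    by rewrite def_w' dtop /= ln scaler0 addr0 addrK.
  apply: (@kin_sub _ _ (Ipiece j.+1)) => [v []//|].
  by apply: (subspaceB (sI _ _ _)); [case: Iw | apply: kdI].
- move=> t w St _ [e Ie def_w]; split=> [It|[e' Ie' def_w']].
    exists (top t + e); last by rewrite linearD.
    apply: (subspaceD (sI _ _ _)) => //=; split=> //; by case: (sI j n i.+1).
  have dt : kd l (top t) = kd l e' - kd l e by rewrite -def_w' def_w addrK.
  have {}dt : kd l (top t) = kd l (e' - e) by rewrite dt; apply/esym/linearB.
  have : kin (Ipiece j) i.+1 (e' - e) := subspaceB (sI _ _ _) Ie' Ie.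
  move: dt; case: (e' - e) => a b; rewrite dtop => -[xt _] [/= Ia Ib].
  (* Injectivity: x t = d a + x b with a and b over I has its coefficients in mI, so mI : x = I puts
     those of t in I. *)
  apply: (kin_colon (Q := mIrow) (a := x) _ St) => [v [cv _] mv|].
    by split=> //; apply: colon_mI; move: mv; rewrite /mIrow mxE.
  rewrite xt ln; apply: kinDD => [v v'||].
  + exact: mIrowD.
  + apply: kd_kin Ia => [k v _||v|v v'].
    * exact: mIrow_scale.
    * exact: mIrow0.
    * exact: mIrowN.
    * exact: mIrowD.
  + by apply: kinZ Ib => v; apply: mIrow_scale.
Qed.

Definition plus_x (A : R -> Prop) f : Prop := exists a g, A a /\ f = a + x * g.
Local Notation J := (plus_x (fun f => f \in I)).
Local Notation mJ := (plus_x mI).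

Lemma is_ideal_plus_x A : is_ideal A -> is_ideal (plus_x A).
Proof.
move=> iA; split=> [|a f g [u [v [Au ->]]] [u' [v' [Au' ->]]]].
  by exists 0, 0; rewrite mulr0 addr0; case: iA.
exists (a * u + u'), (a * v + v'); split; first by case: iA => _; apply.
by rewrite !mulrDr [x * (a * v)]mulrCA addrACA.
Qed.

Lemma scalar_row f : (f%:M : row1) 0 0 = f.
Proof. by rewrite mxE eqxx. Qed.

Lemma ideal_piece_HZ j u : Ipiece j.+1 u -> HZ l (fun=> 0%N) Ipiece 0 j (kemb n.+1 u).
Proof.
move=> Iu; split; first by apply/kembP; exists u.
case: Iu => cu Iu; have [q|b cb def_u] := row_gen l1 lgen cu.
  by rewrite ord1; apply: ideal_const0.
have [e ce de] := kin1_kd l (P := piece j) (r := n.+1) (fun k _ => cb k).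
by exists e => //; rewrite de -def_u.
Qed.

Lemma ideal_piece_HB j u : HB l Ipiece 0 j (kemb n.+1 u) -> mIrow u.
Proof.
case=> e Ie; have [b Ib ->] := kd_kin1 l Ie => /kemb_inj ->.
rewrite /mIrow summxE; apply: (is_ideal_sum is_ideal_mI) => k _ _.
exact: mIrow_scale (Ib k (ltn_ord k)).
Qed.

(** Multiplying a socle basis in degree j - 1 by x gives s elements of I that are independent modulo
    mI, as mI : x = I. Since s is also the dimension of (I / mI)_j, they span it. *)
Lemma generators_mod_x j s f :
  qdim phi (Spiece j) (Ipiece j) s -> betti I 0 j = s ->
  f \in I -> f \is j.-homog -> mJ f.
Proof.
move=> [v [Sv vS vI]] b0 If fj; have := qdim_betti 0 j; rewrite add0n b0 => dH.
pose w i := kemb n.+1 (x *: v i).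
have lw c : lin phi w c = kemb n.+1 (x *: lin phi v c).
  rewrite /lin scaler_sumr linear_sum; apply: eq_bigr => i _.
  by rewrite scalerA mulrC -scalerA [RHS]linearZ.
have Hw i : HZ l (fun=> 0%N) Ipiece 0 j (w i).
  exact/ideal_piece_HZ/Spiece_scale.
have wI : qindep phi (HB l Ipiece 0 j) w.
  move=> c; rewrite lw => /ideal_piece_HB; rewrite /mIrow mxE => /colon_mI Iv.
  by apply: vI; split=> //; case: (subspace_lin c (Spiece_subspace j) Sv).
have [|c] := qindep_span (HB_subspace l 0 (Ipiece_subspace j)) dH Hw wI (z := kemb n.+1 f%:M).
  by apply: ideal_piece_HZ; split; [apply/pieceP | ]; rewrite scalar_row.
rewrite lw -linearB => /ideal_piece_HB;
  rewrite /mIrow mxE scalar_row !mxE => mIf.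
by exists (f - x * lin phi v c 0 0), (lin phi v c 0 0); rewrite subrK.
Qed.

Lemma pihomogM c g : pihomog mdeg c.+1 (x * g) = x * pihomog mdeg c g.
Proof.
have := @gcomp_morph _ _ _ _ (fun=> 0%N) (fun=> 0%N) (GRing.scale x) succn c.+1 (g%:M : row1).
move=> /(_ succn_inj) H; have{H} := H (fun e v => gpieceZ x1).
by move/rowP/(_ 0); rewrite !mxE !subn0 /=.
Qed.

Lemma plus_x_homog c f : f \is c.+1.-homog -> J f ->
  exists a g, [/\ a \in I, a \is c.+1.-homog, g \is c.-homog & f = a + x * g].
Proof.
move=> fc [a [g [Ia def_f]]]; exists (pihomog mdeg c.+1 a), (pihomog mdeg c g).
split; [exact: I_homog | exact: pihomogP | exact: pihomogP |].
by rewrite -pihomogM -pihomogD -def_f pihomog_dE.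
Qed.

Lemma homog_gen c f : f \is c.+1.-homog ->
  exists2 b : nat -> R, forall k, b k \is c.-homog & f = \sum_(k < n.+1) l k * b k.
Proof.
move=> fc; have [||b cb def_f] := row_gen l1 lgen (dg := fun=> 0%N) (c := c.+1) (u := f%:M).
- by apply/pieceP; rewrite scalar_row.
- move=> q; rewrite ord1 scalar_row; apply: (dhomog_nemf_coeff fc).
  by rewrite /= mdeg0.
exists (fun k => b k 0 0) => [k|]; first exact/pieceP.
rewrite -[LHS]scalar_row def_f summxE; apply: eq_bigr => k _.
by rewrite mxE.
Qed.

Definition covers c (A : R -> Prop) := forall f, f \is c.-homog -> A f.

Lemma covers_leq c c' A : is_ideal A -> (c <= c')%N -> covers c A -> covers c' A.
Proof.
move=> iA /subnKC <-; elim: (c' - c)%N => [|k IH] Ac; first by rewrite addn0.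
rewrite addnS => f /homog_gen[b cb ->]; apply: is_ideal_sum => // i _ _.
exact/(is_idealM _ iA)/IH.
Qed.

Lemma ideal_covers : exists C, covers C (fun f => f \in I).
Proof.
have [C IC] := ideal_high; exists C => f fC.
by rewrite -(scalar_row f); apply: (IC C.+1) => //; apply/pieceP;
  rewrite scalar_row.
Qed.

(** * The least socle degree d - 1 and the three conditions *)

Section Degree.
Variable d : nat.
Hypothesis d_pos : (0 < betti I n (n + d))%N.
Hypothesis d_min : forall j, (0 < betti I n (n + j))%N -> (d <= j)%N.

Lemma betti_top j s : qdim phi (Spiece j) (Ipiece j) s -> betti I n (n + j) = s.
Proof. by move/(betti_socle (or_introl erefl)); rewrite binn mul1n. Qed.

Lemma socle_low j u : (j < d)%N -> Spiece j u -> u 0 0 \in I.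
Proof.
move=> lt_jd Su; have [s ds] := socle_dim j.
have s0 : s = 0%N.
  apply/eqP; rewrite -leqn0 leqNgt -(betti_top ds).
  by apply/negP => /d_min; rewrite leqNgt lt_jd.
by rewrite s0 in ds; case: (qdim0 ds Su).
Qed.

Lemma socle_high : exists2 u, Spiece d u & u 0 0 \notin I.
Proof.
have [s ds] := socle_dim d; have := d_pos; rewrite (betti_top ds) => s0.
have [u Su nIu] := qdim_gt0 ds s0; exists u => //.
by apply/negP => Iu; apply: nIu; case: Su.
Qed.

Lemma d_gt0 : (0 < d)%N.
Proof.
have [u [du _] nIu] := socle_high; case: d du => // du; case/negP: nIu.
by rewrite (gpiece0 du) mxE rpred0.
Qed.

Lemma covers_betti i j : covers d J -> (d < j)%N ->
  betti I i (i + j) = ('C(n, i) * betti I 0 j)%N.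
Proof.
move=> Jd lt_dj; have [s ds] := socle_dim j.
suff bs k : betti I k (k + j) = ('C(n, k) * s)%N.
  by rewrite bs -[j in betti I 0 j]add0n bs bin0 mul1n.
apply: betti_socle ds; right; have := d_gt0.
case: j lt_dj => [//|[|j]]; first by case: (d).
(* The piece of index j.+2 has degree j.+1, which is at least d, so J contains its entries. *)
rewrite ltnS => le_dj _; exists j.+1 => // u /pieceP cu.
have := covers_leq (is_ideal_plus_x is_ideal_I) le_dj Jd cu.
case/(plus_x_homog cu) => a [g [Ia ca cg def_u]].
exists a%:M, g%:M; split.
- by split; [apply/pieceP | ]; rewrite scalar_row.
- by apply/pieceP; rewrite scalar_row.
- by apply/rowP => q; rewrite ord1 !mxE eqxx.
Qed.

Lemma covers_WLP : covers d J -> WLP I.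
Proof.
move=> Jd; pose T c := covers c (fun f => f \in I).
(* The top degree of A: [T] fails at 0 and holds at some C. *)
have [c [nTc Tc]] : exists c, ~ T c /\ T c.+1.
  apply: NNPP => noc; have [C TC] := ideal_covers.
  have nT c : ~ T c; last exact: nT TC.
  elim: c => [/(_ 1)|c nTc Tc]; last by apply: noc; exists c.
  by rewrite idealr1 => /(_ (dhomog1 _ _)).
exists c; split.
- have [f nf] : exists f, ~ (f \is c.-homog -> f \in I).
    by apply: NNPP => noF; apply: nTc => f; apply: NNPP => nf; apply: noF;
      exists f.
  have fc : f \is c.-homog by apply: NNPP => nfc; apply: nf.
  exists (\pi f); first by exists f.
  move/eqP; rewrite -(rmorph0 \pi) -Quotient.idealrBE subr0 => If.
  by apply: nf.
- move=> i lt_ci _ [f fi ->]; apply/eqP.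
  rewrite -(rmorph0 \pi) -Quotient.idealrBE subr0.
  exact: covers_leq is_ideal_I lt_ci Tc f fi.
exists (\pi x); first by exists x.
move=> i lt_ic; have [lt_id|le_di] := ltnP i.+1 d; [left | right].
  move=> _ _ [f fi ->] [g gi ->]; rewrite -!rmorphM => /eqP.
  rewrite -Quotient.idealrBE -mulrBr => Ifg.
  apply/eqP; rewrite -Quotient.idealrBE -[f - g]scalar_row.
  apply: (socle_low lt_id); split; last by rewrite scalar_row.
  by apply/pieceP; rewrite scalar_row rpredB.
move=> _ [f fi ->].
have := covers_leq (is_ideal_plus_x is_ideal_I) le_di Jd fi.
case/(plus_x_homog fi) => a [g [Ia ca cg ->]].
exists (\pi g); first by exists g.
by rewrite -rmorphM; apply/eqP; rewrite -Quotient.idealrBE addrK.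
Qed.

Lemma WLP_covers : WLP I -> covers d J.
Proof.
case=> c [_ topc [_ [y y1 ->] Ly]] f fd.
have [lt_cd|le_dc] := ltnP c d.
  have /eqP : \pi_({ideal_quot I}) f = 0 by apply: topc lt_cd _ _; exists f.
  rewrite -(rmorph0 \pi) -Quotient.idealrBE subr0 => If.
  by exists f, 0; rewrite mulr0 addr0.
case d_d' : d d_gt0 => [//|d'] _; have [u [du Iu] nIu] := socle_high.
have yS v : Spiece d v -> y * v 0 0 \in I.
  by case=> _ Iv; apply: socle => //; apply: homog1_const0.
rewrite d_d' in le_dc fd; case: (Ly d' le_dc) => [inj|surj].
  case/negP: nIu; rewrite -[u 0 0]subr0 Quotient.idealrBE; apply/eqP/inj.
  - by exists (u 0 0) => //; apply/pieceP; rewrite -d_d'.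
  - by exists 0 => //; apply: dhomog0.
  by rewrite -!rmorphM; apply/eqP;
    rewrite -Quotient.idealrBE mulr0 subr0 yS // d_d'.
have [|||r dr] := @gpiece_qdim K n.+1 1 (fun=> 0%N) d.+1 (piece d.+1) (Ipiece d.+1).
- exact: gpiece_subspace.
- exact: Ipiece_subspace.
- by [].
case: (dr) => v [cv vS vI].
have lift_v i : exists2 a : row1, piece d a & v i 0 0 - y * a 0 0 \in I.
  have [|_ [a ad' ->] def_v] := surj (\pi_({ideal_quot I}) (v i 0 0)).
    by exists (v i 0 0) => //; apply/pieceP; rewrite -d_d'.
  exists a%:M; first by rewrite d_d'; apply/pieceP; rewrite scalar_row.
  by rewrite scalar_row Quotient.idealrBE rmorphM def_v.
have /fin_all_exists2[a ca Ia] := lift_v.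
have lin00 (w : 'I_r -> row1) e : lin phi w e 0 0 = \sum_i phi (e 0 i) * w i 0 0.
  by rewrite /lin summxE; apply: eq_bigr => i _; rewrite mxE.
pose w i := x *: a i.
have lw e : lin phi w e = x *: lin phi a e.
  by rewrite /lin scaler_sumr; apply: eq_bigr => i _; rewrite /w !scalerA mulrC.
have cw i : piece d.+1 (w i) by apply: gpieceZ.
(* A relation among the x a_i puts a combination of the a_i in the socle, which y kills too; that is
   a relation among the v_i. So these r = dim A_d elements are independent, and hence span A_d. *)
have wI : qindep phi (Ipiece d.+1) w.
  move=> e [_]; rewrite lw mxE => Ixa; apply: vI; split.
    exact: subspace_lin (@gpiece_subspace K n.+1 1 (fun=> 0%N) d.+1) cv.
  have /yS Iya : Spiece d (lin phi a e).
    by split=> //; apply: subspace_lin (@gpiece_subspace K n.+1 1 (fun=> 0%N) d) ca.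
  have -> : lin phi v e 0 0 = (lin phi v e 0 0 - y * lin phi a e 0 0) + y * lin phi a e 0 0.
    by rewrite subrK.
  rewrite rpredD // !lin00 mulr_sumr -sumrB; apply: rpred_sum => i _.
  by rewrite mulrCA -mulrBr idealMr.
have [|e [_]] := qindep_span (Ipiece_subspace d.+1) dr cw wI (z := f%:M).
  by apply/pieceP; rewrite scalar_row d_d'.
rewrite !mxE eqxx lw mxE => If.
by exists (f - x * lin phi a e 0 0), (lin phi a e 0 0); rewrite subrK.
Qed.

Lemma betti_covers (x_lin : x \is 1.-homog) :
  mfull (quot_image (J := lin_ideal x_lin) (@irrelevant K n.+1))
        (quot_image (J := lin_ideal x_lin) (fun f => f \in I)) ->
  (forall j, (d < j)%N -> betti I n (n + j) = betti I 0 j) -> covers d J.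
Proof.
case=> zb zfull bb.
pose pi : R -> {ideal_quot (lin_ideal x_lin : idealr R)} :=
  \pi_({ideal_quot (lin_ideal x_lin : idealr R)}).
have piE f g : pi f = pi g <-> exists h, f - g = x * h.
  split=> [/eqP|h]; first by rewrite -Quotient.idealrBE => /lin_idealP.
  by apply/eqP; rewrite -Quotient.idealrBE; apply/lin_idealP.
have pi0 : pi 0 = 0 := rmorph0 \pi_({ideal_quot (lin_ideal x_lin : idealr R)}).
have piD f g : pi (f + g) = pi f + pi g :=
  rmorphD \pi_({ideal_quot (lin_ideal x_lin : idealr R)}) f g.
have piM f g : pi (f * g) = pi f * pi g :=
  rmorphM \pi_({ideal_quot (lin_ideal x_lin : idealr R)}) f g.
pose z := repr zb; have zbE : zb = pi z by rewrite /pi reprK.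
(* The m-fullness of the quotient pulled back to R, where mI + xR and J are the preimages of the two
   ideals. *)
have zP f : mJ (z * f) <-> J f.
  split=> [[a [g [[s Is ->] def_zf]]]|Jf].
    have : quot_image (J := lin_ideal x_lin) (fun f => f \in I) (pi f).
      apply/zfull; exists [seq (pi q.1, pi q.2) | q <- s] => [_ /mapP[q /Is[mq Iq] ->]|].
        by split; [exists q.1 | exists q.2].
      rewrite big_map zbE -piM def_zf.
      transitivity (pi (\sum_(q <- s) q.1 * q.2)).
        by apply/piE; exists g; rewrite addrC addKr.
      by rewrite (big_morph pi piD pi0); apply: eq_bigr => q _; rewrite piM.
    case=> b Ib /piE[h def_f]; exists b, h; split=> //.
    by rewrite -def_f addrC subrK.
  have : quot_image (J := lin_ideal x_lin) (fun f => f \in I) (pi f).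
    case: Jf => a [g [Ia ->]]; exists a => //; apply/piE; exists g.
    by rewrite addrC addKr.
  move/zfull; rewrite /colon zbE -piM => -[s Is def_zf].
  have [a mIa def_a] : exists2 a, mI a & \sum_(q <- s) q.1 * q.2 = pi a.
    elim: s Is {def_zf} => [|q s IH] Is.
      by exists 0; rewrite ?big_nil ?pi0 //; case: is_ideal_mI.
    have [r sr|b mIb def_b] := IH; first by apply: Is; rewrite inE sr orbT.
    have [[q1 mq1 def_q1] [q2 Iq2 def_q2]] := Is q (mem_head _ _).
    exists (q1 * q2 + b); last by rewrite big_cons def_b def_q1 def_q2 piD piM.
    by apply: is_idealD is_ideal_mI _ mIb; apply: mI_mul => //;
      apply/irrelevantP.
  have /piE[h def_h] : pi (z * f) = pi a by rewrite def_zf def_a.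
  by exists a, h; split=> //; rewrite -def_h addrC subrK.
have iJ := is_ideal_plus_x is_ideal_I; have imJ := is_ideal_plus_x is_ideal_mI.
have [z0|nz0] := eqVneq z@_0%MM 0.
  have [C TC] := ideal_covers.
  have JC c : (C <= c)%N -> covers c J.
    move=> le_Cc f fc; exists f, 0; rewrite mulr0 addr0; split=> //.
    exact: covers_leq is_ideal_I le_Cc TC f fc.
  (* Descending induction on the degree c, with k bounding the distance to C. *)
  suff down k c : (d <= c)%N -> (C <= c + k)%N -> covers c J.
    by apply: (down C) => //; apply: leq_addl.
  elim: k c => [|k IH] c le_dc le_Cc; first by apply: JC;
    rewrite addn0 in le_Cc.
  have Jc1 : covers c.+1 J by apply: IH; rewrite ?addSnnS // ltnW.
  (* As z is in m, z f is a combination of the X_i f, which have degree c.+1 > d. Induction puts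
     them in J, and (ii) puts the part from I in mI + xR. *)
  move=> f fc; apply/zP; have /irrelevantP[g ->] := z0; rewrite mulr_suml.
  apply: is_ideal_sum => // i _ _; rewrite -mulrA; apply: is_idealM => //.
  have Xf : 'X_i * f \is c.+1.-homog.
    by rewrite -(add1n c); apply: dhomogM fc; rewrite dhomogX /= mdeg1.
  have [a [h [Ia ac _ ->]]] := plus_x_homog Xf (Jc1 _ Xf).
  apply: is_idealD => //.
    have [s ds] := socle_dim c.+1.
    apply: (generators_mod_x ds) => //.
    by rewrite -bb ?ltnS // (betti_top ds).
  by exists 0, h; rewrite add0r; split=> //; case: is_ideal_mI.
(* Here z is a nonzero constant modulo m, so z g in mI + xR yields the same for g. *)
have ImJ g : g \in I -> mJ g.
  move=> Ig; have -> : g = (z@_0%MM)^-1 *: (z * g - (z - (z@_0%MM)%:MP) * g).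
    by rewrite mulrBl opprB addrC subrK mul_mpolyC scalerA mulVf // scale1r.
  apply: is_idealZ => //; apply: is_idealB => //.
    by apply/zP; exists g, 0; rewrite mulr0 addr0.
  exists ((z - (z@_0%MM)%:MP) * g), 0; rewrite mulr0 addr0; split=> //.
  by apply: mI_mul => //; rewrite mcoeffB mcoeffC eqxx mulr1 subrr.
(* This is m^k. Feeding I inside mI + xR into itself gives I inside m^k + xR for every k. *)
pose ord k f := forall m, f@_m != 0 -> (k <= mdeg m)%N.
have iord k : is_ideal (ord k).
  split=> [m|a f g kf kg m]; first by rewrite mcoeff0 eqxx.
  rewrite mcoeffD; have [-> |nz _] := eqVneq ((a * f)@_m) 0;
    first by rewrite add0r => /kg.
  move: nz; rewrite -mcoeff_msupp => /msuppM_le/allpairsP[[m1 m2] /= [_]].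
  by rewrite mcoeff_msupp => /kf le_k ->;
    rewrite mdegD (leq_trans le_k) ?leq_addl.
have Iord k g : g \in I -> plus_x (ord k) g.
  elim: k g => [|k IH] g Ig; first by exists g, 0; rewrite mulr0 addr0.
  have [_ [h [[s Is ->] ->]]] := ImJ g Ig.
  have iA := is_ideal_plus_x (iord k.+1); apply: is_idealD => //; last first.
    by exists 0, h; rewrite add0r; split=> //; case: (iord k.+1).
  apply: is_ideal_sum => // q /Is[/irrelevantP q1 /IH[r [t [kr ->]]]] _.
  exists (q.1 * r), (q.1 * t); split;
    last by rewrite mulrDr [q.1 * (x * t)]mulrCA.
  move=> m; rewrite -mcoeff_msupp => /msuppM_le/allpairsP[[m1 m2] /= [m1q]].
  rewrite mcoeff_msupp => /kr le_k ->; rewrite mdegD.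
  rewrite -addn1 addnC leq_add // lt0n mdeg_eq0; apply/eqP => m10.
  by move: m1q; rewrite m10 mcoeff_msupp q1 eqxx.
(* A power of X_i in I is, modulo xR, of order beyond its own degree; comparing parts of that degree
   makes x divide it, and x is prime. *)
have xX i : exists h, 'X_i = x * h.
  have [k Ik] := var_pow i; have [r [h [kr def_X]]] := Iord k.+2 _ Ik.
  have {}def_X : 'X_i ^+ k.+1 = x * pihomog mdeg k h.
    have Xh : ('X_i ^+ k.+1 : R) \is k.+1.-homog.
      have X1 : ('X_i : R) \is 1.-homog by rewrite dhomogX /= mdeg1.
      by have := dhomogMn k.+1 X1; rewrite mul1n.
    rewrite -[LHS](pihomog_dE Xh) def_X raddfD /= pihomogM.
    suff -> : pihomog mdeg k.+1 r = 0 by rewrite add0r.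
    apply/mpolyP => m; rewrite mcoeff_pihomog mcoeff0; case: eqP => // dm.
    by apply/eqP/negPn/negP => /kr; rewrite dm ltnn.
  have {def_X Ik kr} : exists h, 'X_i ^+ k.+1 = x * h by eexists; exact: def_X.
  elim: k.+1 => [|{}k IH] [{}h def_X].
    move/(congr1 (mcoeff 0%MM)): def_X;
      rewrite mcoeff0M (homog1_const0 x1) mul0r.
    by rewrite expr0 mcoeff1 eqxx => /eqP; rewrite oner_eq0.
  case: (@lin_form_prime _ _ _ _ x1 xp 'X_i ('X_i ^+ k)) => //.
  by exists h; rewrite -exprS.
move=> f fd; apply: (is_ideal_const0 iJ) => [i|].
  by have [h ->] := xX i; exists 0, h; rewrite add0r rpred0.
by apply: (dhomog_nemf_coeff fd); rewrite /= mdeg0 eq_sym -lt0n d_gt0.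
Qed.

End Degree.
End MFull.

Theorem theorem11 (K : fieldType) (Kinf : infinite_field K)
  (n : nat) (n_gt0 : (0 < n)%N)
  (I : idealr {mpoly K[n]})
  (I_homog : homogeneous_ideal I)
  (I_primary : irrelevant_primary I)
  (I_mfull : mfull (@irrelevant K n) (fun f => f \in I))
  (d : nat)
  (d_pos : (0 < betti I n.-1 (n.-1 + d))%N)
  (d_min : forall j : nat, (0 < betti I n.-1 (n.-1 + j))%N -> (d <= j)%N)
  (x : {mpoly K[n]}) (x_lin : x \is 1.-homog)
  (x_full : mfull_at (@irrelevant K n) (fun f => f \in I) x)
  (Ibar_mfull : mfull (quot_image (J := lin_ideal x_lin) (@irrelevant K n))
                  (quot_image (J := lin_ideal x_lin) (fun f => f \in I))) :
  (WLP I <->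
   (forall j : nat, (d < j)%N -> betti I n.-1 (n.-1 + j) = betti I 0 j))
  /\
  (WLP I <->
   (forall j : nat, (d < j)%N -> forall i : nat,
      betti I i (i + j) = ('C(n.-1, i) * betti I 0 j)%N)).
Proof.
case: n n_gt0 I I_homog I_primary I_mfull d_pos d_min x x_lin x_full Ibar_mfull
  => // {}n _ {}I I_homog I_primary _ d_pos d_min {}x x_lin x_full Ibar_mfull.
have [p xp] := lin_form_neq0 x_lin (x_neq0 I_primary x_full).
pose cov := covers d (plus_x x (fun f => f \in I)).
have cov_iii : cov -> forall j, (d < j)%N -> forall i,
    betti I i (i + j) = ('C(n, i) * betti I 0 j)%N.
  move=> Jd j lt_dj i.
  exact: (covers_betti I_homog I_primary x_lin x_full xp d_pos) Jd lt_dj.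
have ii_cov : (forall j, (d < j)%N -> betti I n (n + j) = betti I 0 j) -> cov.
  exact: (betti_covers I_homog I_primary x_lin x_full xp d_pos Ibar_mfull).
have cov_wlp : cov -> WLP I.
  exact: (covers_WLP I_homog I_primary x_lin x_full xp d_min).
have wlp_cov : WLP I -> cov.
  exact: (WLP_covers I_homog I_primary x_lin x_full xp d_pos).
have iii_ii : (forall j, (d < j)%N -> forall i,
    betti I i (i + j) = ('C(n, i) * betti I 0 j)%N) ->
    forall j, (d < j)%N -> betti I n (n + j) = betti I 0 j.
  by move=> iii j lt_dj; rewrite iii // binn mul1n.
split; split=> /=.
- by move=> /wlp_cov/cov_iii/iii_ii.
- by move=> /ii_cov/cov_wlp.
- by move=> /wlp_cov/cov_iii.
- by move=> /iii_ii/ii_cov/cov_wlp.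
Qed.
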